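(* Let $n=p+q$, let $G=GL_n(\mathbb{C})$, $B$ the Borel subgroup of upper triangular matrices, and $K=GL_p(\mathbb{C})\times GL_q(\mathbb{C})$ embedded block-diagonally in $G$ (an upper-left $p\times p$ block and a lower-right $q\times q$ block). For a $(p,q)$-clan $\gamma$ let $Q_\gamma$ be the corresponding $K$-orbit on the flag variety $G/B$ and $Y_\gamma=\overline{Q_\gamma}$ its closure. Then for $(p,q)$-clans $\gamma,\tau$, we have $Y_\gamma\subseteq Y_\tau$ if and only if the following three inequalities hold: (1) $\gamma(i;+)\geq \tau(i;+)$ for all $i=1,\dots,n$; (2) $\gamma(i;-)\geq \tau(i;-)$ for all $i=1,\dots,n$; (3) $\gamma(i;j)\leq \tau(i;j)$ for all $1\le i<j\le n$.
   Context: A $(p,q)$-clan is an involution of $\{1,\dots,n\}$ ($n=p+q$) with each fixed point decorated by a sign $+$ or $-$, such that (number of $+$ fixed points) $-$ (number of $-$ fixed points) $=p-q$. It is written as a string $c_1\cdots c_n$: if $i$ is fixed, $c_i$ is its sign; if the involution swaps $i$ and $j$, then $c_i=c_j$ is a natural number, with distinct numbers used for distinct swapped pairs. For a clan $\gamma=c_1\cdots c_n$: $\gamma(i;+)$ is the number of $+$ signs plus the number of pairs of equal natural numbers (both entries) occurring among $c_1\cdots c_i$; $\gamma(i;-)$ is the number of $-$ signs plus the number of such pairs among $c_1\cdots c_i$; and for $i<j$, $\gamma(i;j)$ is the number of pairs $c_s=c_t\in\mathbb{N}$ with $s\le i<j<t$. Let $e_1,\dots,e_n$ be the standard basis of $\mathbb{C}^n$,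 $E_p=\langle e_1,\dots,e_p\rangle$, $\widetilde{E_q}=\langle e_{p+1},\dots,e_n\rangle$, and $\pi:\mathbb{C}^n\to E_p$ the projection onto $E_p$ (with kernel $\widetilde{E_q}$). The orbit $Q_\gamma$ is (by a result of Yamamoto) the set of flags $F_\bullet$ in $\mathbb{C}^n$ with $\dim(F_i\cap E_p)=\gamma(i;+)$, $\dim(F_i\cap\widetilde{E_q})=\gamma(i;-)$ for all $i$, and $\dim(\pi(F_i)+F_j)=j+\gamma(i;j)$ for all $i<j$; $\gamma\mapsto Q_\gamma$ is a bijection between $(p,q)$-clans and $K$-orbits on $G/B$. *)

(* Defs.v *)
From HB Require Import structures.
From mathcomp Require Import all_boot all_order all_fingroup all_algebra.
From mathcomp Require Import complex mpoly.
From mathcomp Require Import classical_sets reals.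

Set Implicit Arguments.
Unset Strict Implicit.
Unset Printing Implicit Defensive.

Import Order.TTheory GRing.Theory Num.Theory.
Local Open Scope ring_scope.

(* Positions are 0-based: the entry c_(s+1) of the string is the entry at      *)
(* s : 'I_(p + q).  [clan_sign c s] is [Some true] for +, [Some false] for -,  *)
(* and [None] when c_(s+1) is a natural number, i.e. is matched with the       *)
(* different position [clan_mate c s].                                         *)
Record clan (p q : nat) := Clan {
  clan_mate : {perm 'I_(p + q)};
  clan_sign : {ffun 'I_(p + q) -> option bool};
  clan_mateK : involutive clan_mate;
  clan_signP : forall s, isSome (clan_sign s) = (clan_mate s == s);
  clan_count :
    #|[pred s | clan_sign s == Some true]|%:Z
      - #|[pred s | clan_sign s == Some false]|%:Z = p%:Z - q%:Z
}.

Section ClanRanks.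
Variables (p q : nat) (c : clan p q).

(* The pairs of equal numbers among c_1, ..., c_i, each counted once, through  *)
(* its left entry.                                                             *)
Definition clan_pairs (i : nat) : nat :=
  #|[pred s : 'I_(p + q) | (s < clan_mate c s)%N && (clan_mate c s < i)%N]|.

Definition clan_signs (b : bool) (i : nat) : nat :=
  #|[pred s : 'I_(p + q) | (clan_sign c s == Some b) && (s < i)%N]|.

Definition clan_plus (i : nat) : nat := (clan_signs true i + clan_pairs i)%N.
Definition clan_minus (i : nat) : nat := (clan_signs false i + clan_pairs i)%N.

(* For i < j, the pairs c_s = c_t with s <= i < j < t in 1-based positions.    *)
Definition clan_cross (i j : nat) : nat :=
  #|[pred s : 'I_(p + q) | (s < i)%N && (j <= clan_mate c s)%N]|.

End ClanRanks.

Section FlagVariety.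
Variables (R : realType) (n : nat).
Local Notation C := R[i].

Definition is_flag (F : {ffun 'I_n.+1 -> {vspace 'cV[C]_n}}) : bool :=
  [forall i : 'I_n.+1, \dim (F i) == i]
  && [forall i : 'I_n.+1, forall j : 'I_n.+1, (i <= j)%N ==> (F i <= F j)%VS].

Definition flag := {F : {ffun 'I_n.+1 -> {vspace 'cV[C]_n}} | is_flag F}.

Definition flag_space (F : flag) : 'I_n.+1 -> {vspace 'cV[C]_n} := sval F.

Definition GL := {g : 'M[C]_n | g \in unitmx}.

Definition column_flag (g : 'M[C]_n) : {ffun 'I_n.+1 -> {vspace 'cV[C]_n}} :=
  [ffun i : 'I_n.+1 => <<[seq col j g | j : 'I_n <- enum 'I_n & (j < i)%N]>>%VS].

Lemma free_cols (g : GL) : free [seq col j (sval g) | j : 'I_n].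
Proof.
have -> : [seq col j (sval g) | j : 'I_n] = [tuple col j (sval g) | j < n] by [].
apply/freeP => k sk0 i; rewrite -[k i]/((fun i => k i) i).
have gk0 : sval g *m (\col_j k j) = 0.
  rewrite -{}[RHS]sk0; apply/colP => a; rewrite mxE summxE.
  by apply: eq_bigr => j _; rewrite -tnth_nth tnth_mktuple !mxE mulrC.
have /colP/(_ i) : \col_j k j = 0.
  by rewrite -[LHS](mulKmx (valP g)) gk0 mulmx0.
by rewrite !mxE.
Qed.

Lemma column_flagP (g : GL) : is_flag (column_flag (sval g)).
Proof.
apply/andP; split; apply/forallP => i; last first.
  apply/forallP => j; apply/implyP => ij; rewrite !ffunE; apply: sub_span => v.
  case/mapP => k; rewrite mem_filter => /andP[ki kn] ->.
  by apply: map_f; rewrite mem_filter kn (leq_trans ki ij).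
rewrite ffunE; set P : pred 'I_n := fun j => (j < i)%N.
have fr : free [seq col j (sval g) | j : 'I_n <- enum 'I_n & P j].
  have injc : injective (fun j => col j (sval g)).
    by apply/injectiveP; rewrite /injectiveb /dinjectiveb free_uniq // free_cols.
  pose Q v := [exists j, P j && (v == col j (sval g))].
  have -> : [seq col j (sval g) | j : 'I_n <- enum 'I_n & P j]
      = filter Q [seq col j (sval g) | j : 'I_n].
    rewrite [RHS]filter_map; congr map.
    apply: eq_filter => j /=; apply/idP/existsP => [Pj|[k]].
      by exists j; rewrite eqxx andbT.
    by case/andP => Pk /eqP /injc ->.
  exact/filter_free/free_cols.
apply/eqP; move/eqP: fr => ->; rewrite size_map size_filter.
have -> : count P (enum 'I_n) = count (fun j => (j < i)%N) (iota 0 n).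
  by rewrite -val_enum_ord count_map; apply: eq_count.
rewrite -[in iota _ _](subnKC (leq_ord i)) iotaD count_cat.
have /eqP -> : count (fun j => (j < i)%N) (iota 0 i) == i.
  rewrite -[X in _ == X](size_iota 0 i) -all_count.
  by apply/allP => j; rewrite mem_iota.
rewrite [X in (_ + X)%N](_ : _ = 0%N) ?addn0 //.
apply/eqP; rewrite -leqn0 leqNgt -has_count -all_predC; apply/allP => j.
by rewrite mem_iota /= -leqNgt => /andP[].
Qed.

(* The quotient map G -> G/B: the flags attached to g and g' are equal iff     *)
(* g' = g b for an invertible upper triangular b.                              *)
Definition flag_of (g : GL) : flag := Sub (column_flag (sval g)) (column_flagP g).

(* The Zariski topology on GL_n.  Polynomials in the entries suffice, as the   *)
(* inverse of the determinant can be cleared from any regular function.        *)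
Definition GL_closed (A : set GL) : Prop :=
  exists S : set {mpoly C[n * n]},
    A = [set g : GL | forall f, S f ->
           f.@[fun k => mxvec (sval g) 0 k] = 0]%classic.

(* The Zariski topology on G/B, as the quotient topology.                      *)
Definition flag_closed (Z : set flag) : Prop :=
  GL_closed (flag_of @^-1` Z)%classic.

Definition flag_closure (Q : set flag) : set flag := smallest flag_closed Q.

(* The left action of GL_n on flags.                                           *)
Definition GL_act_spaces (k : GL) (F : flag) :
    {ffun 'I_n.+1 -> {vspace 'cV[C]_n}} :=
  [ffun i => (linfun (mulmx (sval k)) @: flag_space F i)%VS].

Lemma lker_GL (k : GL) : lker (linfun (mulmx (sval k) : 'cV[C]_n -> 'cV[C]_n)) == 0%VS.
Proof.
apply/lker0P => u v; rewrite !lfunE /= => /(congr1 (mulmx (invmx (sval k)))).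
by rewrite !mulKmx // (valP k).
Qed.

Lemma GL_act_spacesP (k : GL) (F : flag) : is_flag (GL_act_spaces k F).
Proof.
case/andP: (valP F) => /forallP dF /forallP sF.
apply/andP; split; apply/forallP => i.
  rewrite ffunE limg_dim_eq ?(eqP (dF i)) //.
  by rewrite (eqP (lker_GL k)) capv0.
apply/forallP => j; apply/implyP => ij; rewrite !ffunE; apply: limgS.
by move/forallP/(_ j)/implyP: (sF i); apply.
Qed.

Definition GL_act (k : GL) (F : flag) : flag :=
  Sub (GL_act_spaces k F) (GL_act_spacesP k F).

End FlagVariety.

Section Orbits.
Variables (R : realType) (p q : nat).
Local Notation C := R[i].
Local Notation V := 'cV[C]_(p + q).

Definition Ep : {vspace V} :=
  <<[seq (delta_mx (lshift q i) ord0 : V) | i : 'I_p]>>%VS.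

Definition Etq : {vspace V} :=
  <<[seq (delta_mx (rshift p i) ord0 : V) | i : 'I_q]>>%VS.

(* The projection onto Ep with kernel Etq.                                     *)
Definition proj_Ep : 'End(V) := daddv_pi Ep Etq.

Lemma memEp (v : V) : (v \in Ep) = (dsubmx v == 0).
Proof.
apply/idP/eqP => [|v0].
  suff /subvP S : (Ep <= lker (linfun (@dsubmx C p q 1)))%VS.
    by move/S; rewrite memv_ker lfunE => /eqP.
  apply/span_subvP => _ /mapP[k _ ->]; rewrite memv_ker lfunE /=.
  by apply/eqP/colP => j; rewrite !mxE eq_rlshift.
rewrite (matrix_sum_delta v) rpred_sum // => i _.
rewrite big_ord1 -(splitK i); case: (split i) => j /=.
  by rewrite rpredZ // memv_span //; apply/mapP; exists j; rewrite ?mem_enum.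
by have /colP/(_ j) := v0; rewrite !mxE => ->; rewrite scale0r mem0v.
Qed.

Lemma memEtq (v : V) : (v \in Etq) = (usubmx v == 0).
Proof.
apply/idP/eqP => [|v0].
  suff /subvP S : (Etq <= lker (linfun (@usubmx C p q 1)))%VS.
    by move/S; rewrite memv_ker lfunE => /eqP.
  apply/span_subvP => _ /mapP[k _ ->]; rewrite memv_ker lfunE /=.
  by apply/eqP/colP => j; rewrite !mxE eq_lrshift.
rewrite (matrix_sum_delta v) rpred_sum // => i _.
rewrite big_ord1 -(splitK i); case: (split i) => j /=.
  by have /colP/(_ j) := v0; rewrite !mxE => ->; rewrite scale0r mem0v.
by rewrite rpredZ // memv_span //; apply/mapP; exists j; rewrite ?mem_enum.
Qed.

Lemma proj_EpE (v : V) : proj_Ep v = col_mx (usubmx v) 0.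
Proof.
have EE : (Ep :&: Etq = 0)%VS.
  apply/eqP; rewrite -subv0; apply/subvP => u.
  rewrite memv_cap memEp memEtq memv0 => /andP[/eqP d0 /eqP u0].
  by rewrite -[u]vsubmxK d0 u0 col_mx0.
have FE : (Etq :&: Ep = 0)%VS by rewrite capvC.
have {1}-> : v = col_mx (usubmx v) 0 + col_mx 0 (dsubmx v).
  by rewrite add_col_mx addr0 add0r vsubmxK.
have uE : col_mx (usubmx v) 0 \in Ep by rewrite memEp col_mxKd.
have dE : col_mx 0 (dsubmx v) \in Etq by rewrite memEtq col_mxKu.
rewrite linearD /= daddv_pi_id //.
have := @daddv_pi_add _ _ Ep Etq (col_mx 0 (dsubmx v)) EE.
rewrite (daddv_pi_id FE dE) => /(_ (subvP (addvSr _ _) _ dE)) H.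
by rewrite -[X in _ + X](addrK (col_mx 0 (dsubmx v))) H subrr addr0.
Qed.

(* The orbit Q_c attached to the clan c, for K = GL_p x GL_q ([in_K] below).    *)
(* By Yamamoto, this set is a single K-orbit, and c |-> Q_c is a bijection      *)
(* from clans to K-orbits on G/B; only its K-stability is proved here.         *)
Definition clan_orbit (c : clan p q) : set (flag R (p + q)) := [set F |
  [/\ forall i : 'I_(p + q).+1, (0 < i)%N ->
        \dim (flag_space F i :&: Ep) = clan_plus c i,
      forall i : 'I_(p + q).+1, (0 < i)%N ->
        \dim (flag_space F i :&: Etq) = clan_minus c i
    & forall i j : 'I_(p + q).+1, (0 < i < j)%N ->
        \dim (proj_Ep @: flag_space F i + flag_space F j)
          = (j + clan_cross c i j)%N]]%classic.

Definition clan_orbit_closure (c : clan p q) : set (flag R (p + q)) :=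
  flag_closure (clan_orbit c).

Definition in_K (k : GL R (p + q)) : Prop :=
  ursubmx (sval k) = 0 /\ dlsubmx (sval k) = 0.

Lemma clan_orbit_K_stable c k F :
  in_K k -> clan_orbit c F -> clan_orbit c (GL_act k F).
Proof.
case=> ku kd [dimp dimq dimpq]; pose f : 'End(V) := linfun (mulmx (sval k)).
have f0 : lker f == 0%VS := lker_GL k.
have dimf (U : {vspace V}) : \dim (f @: U) = \dim U.
  by rewrite limg_dim_eq // (eqP f0) capv0.
have fcap (U W : {vspace V}) : (f @: W <= W)%VS ->
    \dim (f @: U :&: W) = \dim (U :&: W).
  move=> fW; have /eqP fWE : (f @: W == W)%VS.
    by rewrite -(dimv_leqif_eq fW) dimf.
  rewrite -[in RHS](dimf (U :&: W)%VS) -{1}fWE; congr (\dim _); apply/eqP.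
  rewrite eqEsubv limg_cap andbT; apply/subvP => x.
  rewrite memv_cap => /andP[/memv_imgP[u uU ->] /memv_imgP[w wW]].
  move/(lker0P f0) => uw; apply: memv_img; rewrite memv_cap uU.
  by rewrite uw.
have kE (v : V) :
    f v = col_mx (ulsubmx (sval k) *m usubmx v) (drsubmx (sval k) *m dsubmx v).
  rewrite lfunE /= -{1}[sval k]submxK -{1}[v]vsubmxK ku kd.
  by rewrite mul_block_col !mul0mx addr0 add0r.
have fEp : (f @: Ep <= Ep)%VS.
  apply/subvP => _ /memv_imgP[v vE ->]; move: vE.
  by rewrite !memEp kE col_mxKd => /eqP ->; rewrite mulmx0.
have fEtq : (f @: Etq <= Etq)%VS.
  apply/subvP => _ /memv_imgP[v vE ->]; move: vE.
  by rewrite !memEtq kE col_mxKu => /eqP ->; rewrite mulmx0.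
have fproj (U : {vspace V}) : (proj_Ep @: (f @: U) = f @: (proj_Ep @: U))%VS.
  rewrite -!limg_comp; apply: eq_in_limg => v _; rewrite !comp_lfunE !proj_EpE.
  by rewrite !kE !col_mxKu col_mxKd mulmx0.
have actE i : flag_space (GL_act k F) i = (f @: flag_space F i)%VS.
  by rewrite /flag_space /= ffunE.
split=> [i i0|i i0|i j ij]; rewrite !actE.
- by rewrite fcap // dimp.
- by rewrite fcap // dimq.
- by rewrite fproj -limgD dimf dimpq.
Qed.

End Orbits.

Arguments clan_orbit R {p q} c _.
Arguments clan_orbit_closure R {p q} c _.

(* Main.v *)
Require Import Defs.
From mathcomp Require Import all_boot all_fingroup all_algebra complex mpoly zify.
From mathcomp Require Import classical_sets reals.

(* Write P(i), N(i), X(i, j) for the numbers tau(i;+), tau(i;-), tau(i;j), with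
   X(i, i) the number of pairs s <= i < t, so that P(i) + N(i) + X(i, i) = i.
   The closure of Q_tau is the closed set D_tau of the flags whose ranks satisfy
   the three families of inequalities; as Q_gamma is nonempty, this gives both
   implications.  The inclusion of D_tau in the closure goes by induction on
   the sum of the X(i, i).  If tau has a pair, let i be its rightmost left end:
   entry i + 1 is a sign or a right end.  Exchanging the entries i and i + 1 (or
   turning 11 into +- if they are matched) gives a clan tau' whose ranks differ
   from those of tau only at the index i.  Call two flags adjacent if they
   differ at most in their i-th space.
   - A flag F in D_tau is adjacent to a flag of D_tau': each condition of tau' on
     the i-th space asks that a line of F_(i+1) / F_(i-1) lie in some subspace, and
     these subspaces are nested, except for those of the E_p and E_q conditions,
     which are both binding only if a smaller one is.
   - Given a flag with the ranks of tau away from i, all but finitely many members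
     of a line of adjacent flags lie in Q_tau.  So a closed set containing Q_tau
     contains the flags adjacent to Q_tau', hence, the flags all of whose
     adjacent flags lie in a closed set forming a closed set, those adjacent to
     the closure of Q_tau'.
   If tau has no pair, D_tau = Q_tau. *)

Set Implicit Arguments.
Unset Strict Implicit.
Unset Printing Implicit Defensive.
Import GRing.Theory.

(** * Ranks of clans *)

Section ClanCombinatorics.
Variables (p q : nat).
Local Notation n := (p + q)%N.
Implicit Types (c : clan p q) (s : 'I_n).

(** A pair counts from its right end on, so this is the increment of [clan_plus] from [s] to
    [s.+1]. *)
Definition plus_step c s := (clan_sign c s == Some true) || (clan_mate c s < s)%N.
Definition minus_step c s := (clan_sign c s == Some false) || (clan_mate c s < s)%N.

Lemma card_sum_pred (T : finType) (P : pred T) : #|P| = (\sum_s P s)%N.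
Proof.
rewrite -sum1_card big_mkcond; apply: eq_bigr => s _.
by rewrite unfold_in; case: (P s).
Qed.

Lemma clan_sign_mate c s b : clan_sign c s = Some b -> clan_mate c s = s.
Proof. by move=> e; apply/eqP; rewrite -clan_signP e. Qed.

(** Reindexing by the mate counts each pair through its right entry, so that the ranks become sums
    over the entries before [i]. *)
Lemma clan_pairsE c i :
  clan_pairs c i = (\sum_(s < n) ((clan_mate c s < s) && (s < i)))%N.
Proof.
rewrite /clan_pairs card_sum_pred (reindex_inj (@perm_inj _ (clan_mate c))) /=.
by apply: eq_bigr => s _; rewrite clan_mateK.
Qed.

Lemma clan_plusE c i : clan_plus c i = (\sum_(s < n) (plus_step c s && (s < i)))%N.
Proof.
rewrite /clan_plus clan_pairsE /clan_signs card_sum_pred -big_split /=.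
apply: eq_bigr => s _; rewrite /plus_step.
by case: eqP => [/clan_sign_mate->|_] //=; rewrite ltnn addn0.
Qed.

Lemma clan_minusE c i : clan_minus c i = (\sum_(s < n) (minus_step c s && (s < i)))%N.
Proof.
rewrite /clan_minus clan_pairsE /clan_signs card_sum_pred -big_split /=.
apply: eq_bigr => s _; rewrite /minus_step.
by case: eqP => [/clan_sign_mate->|_] //=; rewrite ltnn addn0.
Qed.

Lemma clan_crossE c i j :
  clan_cross c i j = (\sum_(s < n) ((j <= clan_mate c s) && (s < i)))%N.
Proof.
by rewrite /clan_cross card_sum_pred; apply: eq_bigr => s _; rewrite andbC.
Qed.

Lemma sum_threshold (P : pred 'I_n) s :
  (\sum_(t < n) (P t && (t < s.+1)) = \sum_(t < n) (P t && (t < s)) + P s)%N.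
Proof.
rewrite (bigD1 s) // [in RHS](bigD1 s) //= ltnn andbF ltnSn andbT add0n addnC.
congr (_ + _)%N; apply: eq_bigr => t ts; congr nat_of_bool.
have : (t : nat) <> s by move/val_inj/eqP; rewrite (negPf ts).
lia.
Qed.

Lemma clan_plusS c s : clan_plus c s.+1 = (clan_plus c s + plus_step c s)%N.
Proof. by rewrite !clan_plusE sum_threshold. Qed.

Lemma clan_minusS c s : clan_minus c s.+1 = (clan_minus c s + minus_step c s)%N.
Proof. by rewrite !clan_minusE sum_threshold. Qed.

Lemma clan_crossSl c s j :
  clan_cross c s.+1 j = (clan_cross c s j + (j <= clan_mate c s))%N.
Proof.
rewrite !clan_crossE.
exact: (sum_threshold (fun t : 'I_n => j <= clan_mate c t)%N).
Qed.

(** Moving the right threshold past [s] affects a single entry, the mate of [s]. *)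
Lemma clan_crossSr c i s :
  clan_cross c i s = (clan_cross c i s.+1 + (clan_mate c s < i))%N.
Proof.
rewrite !clan_crossE (bigD1 (clan_mate c s)) // [in RHS](bigD1 (clan_mate c s)) //=.
rewrite clan_mateK leqnn ltnn andTb andFb add0n addnC.
congr (_ + _)%N; apply: eq_bigr => t ts; congr nat_of_bool.
have : (clan_mate c t : nat) <> s.
  by move/val_inj => e; move: ts; rewrite -e clan_mateK eqxx.
lia.
Qed.

Lemma clan_plus0 c : clan_plus c 0 = 0%N.
Proof. by rewrite clan_plusE big1 // => s _; rewrite ltn0 andbF. Qed.

Lemma clan_minus0 c : clan_minus c 0 = 0%N.
Proof. by rewrite clan_minusE big1 // => s _; rewrite ltn0 andbF. Qed.

Lemma clan_cross0 c j : clan_cross c 0 j = 0%N.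
Proof. by rewrite clan_crossE big1 // => s _; rewrite ltn0 andbF. Qed.

Lemma position_trichotomy c s :
  [\/ [/\ clan_mate c s = s, plus_step c s + minus_step c s = 1%N
       & isSome (clan_sign c s)],
      [/\ (clan_mate c s < s)%N, plus_step c s & minus_step c s]
    | [/\ (s < clan_mate c s)%N, plus_step c s = false
        & minus_step c s = false]].
Proof.
have := clan_signP c s; rewrite /plus_step /minus_step.
case: (clan_sign c s) => [b|] /= /esym.
  move/eqP=> e; constructor 1; rewrite e ltnn; split=> //; by case: b.
move=> /negbT; rewrite -(inj_eq val_inj) neq_ltn => /orP[lt|lt].
  by constructor 2; rewrite lt.
by constructor 3; rewrite lt; split=> //; rewrite ltnNge ltnW.
Qed.

(** Among the first [k] entries, a sign counts once, a completed pair counts twice for its two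
    entries, and a pair still open counts once, as crossing. *)
Lemma clan_rank_sum c k : (k <= n)%N ->
  (clan_plus c k + clan_minus c k + clan_cross c k k = k)%N.
Proof.
elim: k => [|k IH] lt; first by rewrite clan_plus0 clan_minus0 clan_cross0.
have := IH (ltnW lt); pose s := Ordinal lt; rewrite -[k]/(nat_of_ord s).
rewrite clan_plusS clan_minusS clan_crossSl [clan_cross c s s]clan_crossSr.
case: (position_trichotomy c s) => [[-> e _]|[lts -> ->]|[gts -> ->]]; lia.
Qed.

Lemma clan_plus_step c i : (i < n)%N ->
  (clan_plus c i <= clan_plus c i.+1 <= (clan_plus c i).+1)%N.
Proof.
by move=> lt; have := clan_plusS c (Ordinal lt); case: (plus_step _ _) => /=; lia.
Qed.

Lemma clan_minus_step c i : (i < n)%N ->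
  (clan_minus c i <= clan_minus c i.+1 <= (clan_minus c i).+1)%N.
Proof.
by move=> lt; have := clan_minusS c (Ordinal lt); case: (minus_step _ _) => /=; lia.
Qed.

Lemma clan_cross_stepl c i j : (i < n)%N ->
  (clan_cross c i j <= clan_cross c i.+1 j <= (clan_cross c i j).+1)%N.
Proof.
by move=> lt; have := clan_crossSl c (Ordinal lt) j; case: (leq _ _) => /=; lia.
Qed.

Lemma clan_cross_stepr c i j : (j < n)%N ->
  (clan_cross c i j.+1 <= clan_cross c i j <= (clan_cross c i j.+1).+1)%N.
Proof.
by move=> lt; have := clan_crossSr c i (Ordinal lt); case: (leq _ _) => /=; lia.
Qed.

Record agree_off (i : nat) c c' : Prop := AgreeOff {
  agree_plus : forall k, k <> i -> clan_plus c k = clan_plus c' k;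
  agree_minus : forall k, k <> i -> clan_minus c k = clan_minus c' k;
  agree_cross : forall k j, (k <= j)%N -> k <> i -> j <> i ->
    clan_cross c k j = clan_cross c' k j }.

(** Only the threshold [y] separates [x] from its successor [y]. *)
Lemma tperm_lt (x y s : 'I_n) (k : nat) :
  y = x.+1 :> nat -> k <> y -> (tperm x y s < k)%N = (s < k)%N.
Proof. by move=> xy ky; case: tpermP => [->|->|//]; lia. Qed.

(** An adjacent transposition reverses the order of its two points and of no other pair. *)
Lemma tperm_lt2 (x y s s' : 'I_n) :
  y = x.+1 :> nat -> ~~ ((s \in [:: x; y]) && (s' \in [:: x; y])) ->
  (tperm x y s < tperm x y s')%N = (s < s')%N.
Proof.
move=> xy; rewrite !inE; have V (a b : 'I_n) : (a == b) = (a == b :> nat) by [].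
case: (tpermP x y s) => [->|->|/eqP+ /eqP+];
  case: (tpermP x y s') => [->|->|/eqP+ /eqP+]; rewrite ?eqxx ?orbT //= !V; lia.
Qed.

Lemma agree_offC i c c' : agree_off i c c' -> agree_off i c' c.
Proof. by case=> ap am ac; split=> *; [rewrite ap|rewrite am|rewrite ac]. Qed.

(** * Exchanging two adjacent unmatched entries *)

Section Swap.
Variables (c : clan p q) (x y : 'I_n).
Hypothesis xy : y = x.+1 :> nat.
Hypothesis nmate : clan_mate c x != y.
Local Notation t := (tperm x y).

Let mate := (t * clan_mate c * t)%g.
Let sign := [ffun s => clan_sign c (t s)].

Let mateE s : mate s = t (clan_mate c (t s)).
Proof. by rewrite !permM. Qed.

Fact swap_mateK : involutive mate.
Proof. by move=> s; rewrite !mateE tpermK clan_mateK tpermK. Qed.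

Fact swap_signP s : isSome (sign s) = (mate s == s).
Proof. by rewrite ffunE clan_signP mateE -(inj_eq (@perm_inj _ t) (clan_mate c _)) tpermK. Qed.

Fact swap_count : (#|[pred s | sign s == Some true]|%:Z
      - #|[pred s | sign s == Some false]|%:Z = p%:Z - q%:Z)%R.
Proof.
rewrite -(clan_count c); do 2?congr (_ - _)%R; congr (_%:Z)%R;
  rewrite !card_sum_pred [RHS](reindex_inj (@perm_inj _ t)) /=;
  by apply: eq_bigr => s _; rewrite ffunE.
Qed.

Definition clan_swap := Clan swap_mateK swap_signP swap_count.

(** Reindex by [t]: it respects every threshold other than [y], and also the order of each entry and
    its mate, since [x] and [y] are not matched. *)
Lemma agree_swap : agree_off y c clan_swap.
Proof.
have mlt s : (mate (t s) < t s)%N = (clan_mate c s < s)%N.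
  rewrite mateE tpermK.
  have [e|e] := eqVneq (clan_mate c s) s; first by rewrite e !ltnn.
  apply: tperm_lt2 => //; rewrite !inE; apply/negP => /andP[/orP[]/eqP e1 /orP[]/eqP e2];
    move: e nmate; rewrite e1 e2 ?eqxx //.
    by rewrite -[x in clan_mate c x]e1 clan_mateK e2 eqxx.
  by rewrite -e2 e1 eqxx.
split=> [k ky|k ky|k j kj ky jy].
- rewrite !clan_plusE [RHS](reindex_inj (@perm_inj _ t)) /=.
  by apply: eq_bigr => s _; rewrite tperm_lt // /plus_step /= mlt ffunE tpermK.
- rewrite !clan_minusE [RHS](reindex_inj (@perm_inj _ t)) /=.
  by apply: eq_bigr => s _; rewrite tperm_lt // /minus_step /= mlt ffunE tpermK.
- rewrite !clan_crossE [RHS](reindex_inj (@perm_inj _ t)) /=.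
  apply: eq_bigr => s _; rewrite tperm_lt // mateE tpermK.
  by rewrite [in RHS]leqNgt tperm_lt // -leqNgt.
Qed.

End Swap.

(** * Replacing an adjacent matched pair by the signs +- *)

Section Unmatch.
Variables (c : clan p q) (x y : 'I_n).
Hypothesis xy : y = x.+1 :> nat.
Hypothesis matexy : clan_mate c x = y.
Local Notation t := (tperm x y).

Let mate := (clan_mate c * t)%g.
Let sign := [ffun s => if s == x then Some true else
                       if s == y then Some false else clan_sign c s].
Let mateyx : clan_mate c y = x. Proof. by rewrite -matexy clan_mateK. Qed.
Let xny : (x == y) = false.
Proof. by rewrite -(inj_eq val_inj) /= xy; lia. Qed.
Let yny : (y == x) = false. Proof. by rewrite eq_sym. Qed.

Let matex : mate x = x. Proof. by rewrite permM matexy tpermR. Qed.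
Let matey : mate y = y. Proof. by rewrite permM mateyx tpermL. Qed.
Let mateE s : s != x -> s != y -> mate s = clan_mate c s.
Proof.
move=> sx sy; rewrite permM tpermD //.
  by rewrite -mateyx (inj_eq perm_inj) eq_sym.
by rewrite -matexy (inj_eq perm_inj) eq_sym.
Qed.

Fact unmatch_mateK : involutive mate.
Proof.
move=> s; have [->|sx] := eqVneq s x; first by rewrite !matex.
have [->|sy] := eqVneq s y; first by rewrite !matey.
rewrite [mate s]mateE // mateE ?clan_mateK //.
  by rewrite -mateyx (inj_eq perm_inj).
by rewrite -matexy (inj_eq perm_inj).
Qed.

Fact unmatch_signP s : isSome (sign s) = (mate s == s).
Proof.
rewrite ffunE; have [->|sx] := eqVneq s x; first by rewrite matex eqxx.
have [->|sy] := eqVneq s y; first by rewrite matey eqxx.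
by rewrite mateE // clan_signP.
Qed.

Let signx : clan_sign c x = None.
Proof. by move: (clan_signP c x); rewrite matexy yny; case: (clan_sign c x). Qed.
Let signy : clan_sign c y = None.
Proof. by move: (clan_signP c y); rewrite mateyx xny; case: (clan_sign c y). Qed.

(** The new + and the new - cancel in the difference. *)
Fact unmatch_count : (#|[pred s | sign s == Some true]|%:Z
      - #|[pred s | sign s == Some false]|%:Z = p%:Z - q%:Z)%R.
Proof.
rewrite -(clan_count c) !card_sum_pred.
have S (b : bool) : (\sum_s [pred s | sign s == Some b] s =
    (\sum_s [pred s | clan_sign c s == Some b] s).+1)%N.
  have D (f : 'I_n -> nat) :
      (\sum_s f s = f x + f y + \sum_(s < n | (s != x) && (s != y)) f s)%N.
    by rewrite (bigD1 x) // (bigD1 y) ?yny //= addnA.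
  rewrite !D /= !ffunE !eqxx yny signx signy /=.
  rewrite (eq_bigr (fun s => clan_sign c s == Some b : nat)); first by case: b.
  by move=> s /andP[/negPf sx /negPf sy]; rewrite ffunE sx sy.
rewrite !S; lia.
Qed.

Definition clan_unmatch := Clan unmatch_mateK unmatch_signP unmatch_count.

(** The + counts from index [y] on, while the old pair and the - count from [y.+1] on. For [k <= j],
    the old pair crosses only at [k = j = y]. *)
Lemma agree_unmatch : agree_off y c clan_unmatch.
Proof.
split=> [k ky|k ky|k j kj ky jy].
- rewrite !clan_plusE [RHS](reindex_inj (@perm_inj _ t)) /=.
  (* The reindexing matches the right end of the pair, at [y], with the + at [x]; for [clan_minus]
     both contributions sit at [y]. *)
  apply: eq_bigr => s _; rewrite tperm_lt // /plus_step /= ffunE.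
  case: tpermP => [->|->|/eqP sx /eqP sy].
  + by rewrite yny eqxx matey signx matexy xy ltnn /= ltnNge leqW.
  + by rewrite eqxx matex signy mateyx xy ltnSn /=.
  + by rewrite (negPf sx) (negPf sy) mateE.
- rewrite !clan_minusE; apply: eq_bigr => s _; rewrite /minus_step /= ffunE.
  have [->|sx] := eqVneq s x.
    by rewrite matex signx matexy xy ltnn /= ltnNge leqW.
  have [->|sy] := eqVneq s y; last by rewrite mateE.
  by rewrite mateyx xy ltnSn orbT.
- rewrite !clan_crossE; apply: eq_bigr => s _ /=.
  have [->|sx] := eqVneq s x; first by rewrite matex matexy; lia.
  have [->|sy] := eqVneq s y; first by rewrite matey mateyx; lia.
  by rewrite mateE.
Qed.

End Unmatch.

Definition clan_weight c := (\sum_(i < n.+1) clan_cross c i i)%N.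

(** Positions are 0-based: the rightmost left end is [x], and the index at which the ranks change is
    [x.+1], that is [y]. *)
Lemma clan_descent c s0 : (s0 < clan_mate c s0)%N ->
  exists (c' : clan p q) (x y : 'I_n),
    [/\ y = x.+1 :> nat, (x < clan_mate c x)%N, (clan_mate c y <= y)%N,
        agree_off y c c' & (clan_weight c' < clan_weight c)%N].
Proof.
move=> Ls0; pose L s := (s < clan_mate c s)%N.
case: (@arg_maxnP _ s0 L (fun s => s) Ls0) => x Lx maxx.
have yn : (x.+1 < n)%N by apply: leq_ltn_trans Lx _.
pose y := Ordinal yn; have xy : y = x.+1 :> nat by [].
have nLy : (clan_mate c y <= y)%N.
  by rewrite leqNgt; apply/negP => /maxx /=; rewrite ltnn.
(* Only the term [y] of the weight changes. As [x] is a left end of [c], its plus and minus ranks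
   are constant from [x] to [y]; if their sum grows for [c'], then [clan_rank_sum] makes the
   crossing term of [c'] smaller. So it is enough that [x] is not a left end of [c']. *)
suff [c' agr dec] : exists2 c', agree_off y c c' &
    (clan_plus c' x + clan_minus c' x < clan_plus c' y + clan_minus c' y)%N.
  exists c', x, y; split=> //; rewrite /clan_weight.
  have yn1 : (y < n.+1)%N by lia.
  rewrite (bigD1 (Ordinal yn1)) //= [ltnRHS](bigD1 (Ordinal yn1)) //=.
  rewrite [X in (_ + X < _)%N](eq_bigr (fun i : 'I_n.+1 => clan_cross c i i)).
    rewrite ltn_add2r.
    have [r1 r2] : (y <= n /\ x <= n)%N by lia.
    have := clan_rank_sum c' r1; have := clan_rank_sum c r1.
    have := clan_rank_sum c' r2; have := clan_rank_sum c r2.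
    have xny : (x : nat) <> y by lia.
    have := agree_plus agr xny; have := agree_minus agr xny.
    have := clan_plusS c x; have := clan_minusS c x.
    move: Lx dec; rewrite /L xy.
    have [[-> _ _]|[]|[_ -> ->]] := position_trichotomy c x; lia.
  move=> i iy; apply/esym/(agree_cross agr) => // e;
    by case/eqP: iy; apply: val_inj.
have step (c' : clan p q) : (clan_mate c' x <= x)%N ->
    (clan_plus c' x + clan_minus c' x < clan_plus c' y + clan_minus c' y)%N.
  rewrite xy clan_plusS clan_minusS.
  by case: (position_trichotomy c' x) => [[_ e _]|[_ -> ->]|[]]; lia.
have [e|ne] := eqVneq (clan_mate c x) y.
  exists (clan_unmatch xy e); first exact: agree_unmatch.
  by apply: step; rewrite /= permM e tpermR.
exists (clan_swap c x y); first exact: agree_swap.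
apply: step; rewrite /= !permM tpermL.
case: tpermP => [e|_|/eqP ex /eqP ey]; rewrite ?leqnn //.
  by move: ne; rewrite -e clan_mateK eqxx.
have : (clan_mate c y : nat) <> y by move/val_inj/eqP; rewrite (negPf ey).
by lia.
Qed.

Lemma unmatched_clan c : (forall s, clan_mate c s <= s)%N -> clan_mate c =1 id.
Proof.
move=> H s; apply/val_inj/eqP; rewrite eqn_leq H /=.
by rewrite -[X in (X <= _)%N](congr1 val (clan_mateK c s)) H.
Qed.

End ClanCombinatorics.

Local Open Scope ring_scope.

(** * Linear algebra *)

Section LinearAlgebra.
Variables (K : fieldType) (aT rT : vectType K).
Implicit Types (f : 'Hom(aT, rT)) (X : {vspace aT}) (U T : {vspace rT}).

Lemma dim_add_line U u : \dim (U + <[u]>) = (\dim U + (u \notin U))%N.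
Proof.
have [uU|uU] := boolP (u \in U); first by rewrite (addv_idPl _) ?addn0 // -memvE.
rewrite dimv_disjoint_sum ?dim_vline.
  by case: eqP uU => // ->; rewrite mem0v.
apply/eqP; rewrite -subv0; apply/subvP => w; rewrite memv_cap memv0 => /andP[wU].
case/vlineP => a wE; have [a0|a0] := eqVneq a 0; first by rewrite wE a0 scale0r.
by case/negP: uU; rewrite -[u](scalerK a0) -wE memvZ.
Qed.

Lemma dim_limg_add_line f X U v :
  \dim (f @: (X + <[v]>) + U) = (\dim (f @: X + U) + (f v \notin f @: X + U)%VS)%N.
Proof. by rewrite limgD limg_line -addvA [(<[_]> + _)%VS]addvC addvA dim_add_line. Qed.

(** The map induced by [f] from the plane spanned by [v] and [w] modulo [X] to the quotient by
    [f @: X + U] has rank at most one, hence a nonzero kernel. *)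
Lemma slow_growth_vector f X U v w :
  v \notin X -> w \notin (X + <[v]>)%VS ->
  (\dim (f @: (X + <[v]> + <[w]>) + U) <= (\dim (f @: X + U)).+1)%N ->
  exists2 u, u \in (X + <[v]> + <[w]>)%VS & (u \notin X) && (f u \in f @: X + U)%VS.
Proof.
move=> vX wX; have [fv _|fv] := boolP (f v \in f @: X + U)%VS.
  exists v; last by rewrite vX fv.
  by apply/(subvP (addvSl _ _))/(subvP (addvSr _ _)); apply: memv_line.
rewrite dim_limg_add_line dim_limg_add_line fv addn1.
case: (boolP (f w \in _)) => [fw _|_]; last by rewrite addn1 ltnn.
have : (f w \in (f @: X + U) + <[f v]>)%VS.
  by move: fw; rewrite limgD limg_line -addvA [(<[_]> + _)%VS]addvC addvA.
case/memv_addP => t tT [_ /vlineP[a ->] e].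
exists (w - a *: v).
  rewrite memvB //; first by apply/(subvP (addvSr _ _)); apply: memv_line.
  apply/memvZ/(subvP (addvSl _ _))/(subvP (addvSr _ _)); exact: memv_line.
have -> : f (w - a *: v) = t by rewrite linearB linearZ /= e addrK.
rewrite tT andbT.
apply: contra wX => wX; rewrite -[w](subrK (a *: v)).
by apply: memv_add => //; apply/memvZ/memv_line.
Qed.

(* At most one vector of the pencil [v + t w] is mapped into a subspace which
   does not contain the image of the whole plane. *)
Lemma pencil_generic_dim f X U v w : exists t0 : K, forall t : K, t != t0 ->
  \dim (f @: (X + <[v + t *: w]>) + U) =
    minn (\dim (f @: X + U)).+1 (\dim (f @: (X + <[v]> + <[w]>) + U)).
Proof.
set T := (f @: X + U)%VS.
have [[t1 ft1]|none] := boolp.EM (exists t1, f (v + t1 *: w) \in T); last first.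
  exists 0 => t _; rewrite dim_limg_add_line -/T.
  have -> : f (v + t *: w) \notin T by apply/negP => ft; apply: none; exists t.
  rewrite addn1; apply/esym/minn_idPl.
  rewrite !dim_limg_add_line -/T; have -> : f v \notin T.
    by apply/negP => fv; apply: none; exists 0; rewrite scale0r addr0.
  by rewrite addn1 leq_addr.
exists t1 => t tt1; rewrite !dim_limg_add_line -/T.
(* Modulo [T], the image of [v + t *: w] is the nonzero multiple [t - t1] of that of [w]. *)
have key : (f (v + t *: w) \in T) = (f w \in T).
  have -> : f (v + t *: w) = f (v + t1 *: w) + (t - t1) *: f w.
    by rewrite !linearD !linearZ /= -addrA -scalerDl [(t1 + _)%R]addrC subrK.
  by rewrite rpredDl // rpredZeq subr_eq0 (negPf tt1).
have keyv : f w \in T -> f v \in T.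
  by move=> fw; rewrite -[v](addrK (t1 *: w)) linearB linearZ rpredB // memvZ.
rewrite key; case: (boolP (f w \in T)) => fw.
  rewrite keyv // addn0; have -> : f w \in (f @: (X + <[v]>) + U)%VS.
    by apply: subvP fw; apply: addvS => //; apply/limgS/addvSl.
  by rewrite addn0; apply/esym/minn_idPr.
rewrite addn1; apply/esym/minn_idPl.
case: (boolP (f v \in T)) => fv; last by rewrite addn1 leq_addr.
suff -> : f w \notin (f @: (X + <[v]>) + U)%VS by rewrite addn0 addn1.
apply: contra fw; apply: subvP; rewrite limgD limg_line -addvA [(<[_]> + _)%VS]addvC addvA.
by rewrite subv_add subvv -memvE.
Qed.

Lemma limg_mulmx_row (m m1 m2 : nat) (M1 : 'M[K]_(m, m1)) (M2 : 'M[K]_(m, m2)) :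
  limg (linfun (mulmx (row_mx M1 M2) : 'cV_(m1 + m2) -> 'cV_m)) =
    (limg (linfun (mulmx M1 : 'cV_m1 -> 'cV_m)) +
     limg (linfun (mulmx M2 : 'cV_m2 -> 'cV_m)))%VS.
Proof.
apply/eqP; rewrite eqEsubv; apply/andP; split; apply/subvP => u.
  case/memv_imgP => z _ ->; rewrite lfunE /= -[z]vsubmxK mul_row_col.
  by apply: memv_add; apply/memv_imgP; eexists; rewrite ?memvf ?lfunE.
case/memv_addP => _ /memv_imgP[a _ ->] [_ /memv_imgP[b _ ->] ->].
apply/memv_imgP; exists (col_mx a b); rewrite ?memvf // !lfunE /=.
by rewrite mul_row_col.
Qed.

Lemma rank_factorization (m1 m2 : nat) (M : 'M[K]_(m1, m2)) :
  exists (A : 'M_(m1, \rank M)) (B : 'M_(\rank M, m2)) A' B',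
    [/\ M = A *m B, A' *m A = 1%:M & B *m B' = 1%:M].
Proof.
have /row_fullP[A' AK] := col_base_full M; have /row_freeP[B' BK] := row_base_free M.
by exists (col_base M), (row_base M), A', B'; rewrite mulmx_base.
Qed.

Lemma dim_limg_mulmx (m1 m2 : nat) (M : 'M[K]_(m1, m2)) :
  \dim (limg (linfun (mulmx M : 'cV_m2 -> 'cV_m1))) = \rank M.
Proof.
have [A [B [A' [B' [ME AK BK]]]]] := rank_factorization M.
move: (\rank M) => r in A B A' B' ME AK BK *.
pose g : 'Hom('cV[K]_r, 'cV[K]_m1) := linfun (mulmx A).
have -> : limg (linfun (mulmx M : 'cV_m2 -> 'cV_m1)) = limg g.
  apply/eqP; rewrite eqEsubv; apply/andP; split; apply/subvP => u /memv_imgP[z _ ->].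
    by apply/memv_imgP; exists (B *m z); rewrite ?memvf // !lfunE /= mulmxA -ME.
  apply/memv_imgP; exists (B' *m z); rewrite ?memvf // !lfunE /=.
  by rewrite ME -mulmxA (mulmxA B) BK mul1mx.
rewrite limg_dim_eq; first by rewrite dimvf /dim /= muln1.
apply/eqP; rewrite capfv; apply/lker0P => a b; rewrite !lfunE /=.
by move/(congr1 (mulmx A')); rewrite !mulmxA AK !mul1mx.
Qed.

(** Serves as a nonvanishing minor: for fixed [P] and [Q], the determinant of the product is a
    polynomial in the entries of [M]. *)
Lemma rank_minor (m1 m2 r : nat) (M : 'M[K]_(m1, m2)) : (r <= \rank M)%N ->
  exists P Q, P *m M *m Q = 1%:M :> 'M_r.
Proof.
have [A [B [A' [B' [ME AK BK]]]]] := rank_factorization M.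
move: (\rank M) => s in A B A' B' ME AK BK * => rs.
exists (pid_mx r *m A'), (B' *m pid_mx r).
rewrite ME !mulmxA -(mulmxA _ A') AK mulmx1 -(mulmxA _ B) BK mulmx1.
by rewrite mul_pid_mx minnn (minn_idPr rs) pid_mx_1.
Qed.

End LinearAlgebra.

(** * Flags and the Zariski topology *)

Section Flags.
Variables (R : realType) (n : nat).
Local Notation C := R[i].
Local Notation V := 'cV[C]_n.
Implicit Types (F G : flag R n) (k j x : nat).

(** Natural indices make [x.+1] and [x.+2] available without casts. Beyond [n], [inord] falls back
    to 0, hence the bounds [k <= n] below. *)
Definition fs F k : {vspace V} := flag_space F (inord k).

Lemma flag_spaceE F (i : 'I_n.+1) : flag_space F i = fs F i.
Proof. by rewrite /fs inord_val. Qed.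

Lemma fs_dim F k : (k <= n)%N -> \dim (fs F k) = k.
Proof.
move=> kn; case/andP: (valP F) => /forallP/(_ (inord k))/eqP dF _.
by rewrite /fs /flag_space dF inordK.
Qed.

Lemma fs_mono F k j : (k <= j)%N -> (j <= n)%N -> (fs F k <= fs F j)%VS.
Proof.
move=> kj jn; case/andP: (valP F) => _ /forallP/(_ (inord k))/forallP/(_ (inord j)).
by rewrite !inordK ?ltnS ?(leq_trans kj) // kj.
Qed.

Lemma fs0 F : fs F 0 = 0%VS.
Proof. by apply/eqP; rewrite -dimv_eq0 fs_dim. Qed.

Lemma flag_eq F G : (forall k, (k <= n)%N -> fs F k = fs G k) -> F = G.
Proof.
move=> FG; apply: val_inj; apply/ffunP => i.
by have := FG i (leq_ord i); rewrite -!flag_spaceE.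
Qed.

Lemma flag_build (E : nat -> {vspace V}) :
  (forall k, (k <= n)%N -> \dim (E k) = k) ->
  (forall k, (k < n)%N -> (E k <= E k.+1)%VS) ->
  exists F, forall k, (k <= n)%N -> fs F k = E k.
Proof.
move=> dE mE.
have mono k j : (k <= j)%N -> (j <= n)%N -> (E k <= E j)%VS.
  elim: j => [|j IH]; first by rewrite leqn0 => /eqP->.
  rewrite leq_eqVlt => /orP[/eqP->//|kj] jn.
  by apply: subv_trans (mE _ jn); apply: IH => //; apply: ltnW.
have isF : is_flag [ffun i : 'I_n.+1 => E i].
  apply/andP; split; apply/forallP => i; first by rewrite ffunE dE // leq_ord.
  by apply/forallP => j; apply/implyP => ij; rewrite !ffunE mono // leq_ord.
exists (Sub _ isF) => k kn.
by rewrite /fs /flag_space SubK ffunE inordK.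
Qed.

Lemma flag_step F k : (k < n)%N ->
  exists v, v \notin fs F k /\ fs F k.+1 = (fs F k + <[v]>)%VS.
Proof.
move=> kn; have sub := fs_mono F (leqnSn k) kn.
have [v vS vk] : exists2 v, v \in fs F k.+1 & v \notin fs F k.
  apply/subvPn; apply: contraTN (leqnn k.+1) => sub'.
  by rewrite -{2}(fs_dim F kn) -ltnNge ltnS -{2}(fs_dim F (ltnW kn)) dimvS.
exists v; split=> //; apply/eqP; rewrite eq_sym eqEdim subv_add sub -memvE vS /=.
by rewrite dim_add_line vk !fs_dim ?addn1 // ltnW.
Qed.

Definition adjacent x F G := forall k, (k <= n)%N -> k <> x -> fs G k = fs F k.

Lemma adjacentC x F G : adjacent x F G -> adjacent x G F.
Proof. by move=> FG k kn kx; rewrite FG. Qed.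

Lemma flag_modify x F v : (x.+2 <= n)%N -> v \in fs F x.+2 -> v \notin fs F x ->
  exists2 G, adjacent x.+1 F G & fs G x.+1 = (fs F x + <[v]>)%VS.
Proof.
move=> xn v2 vx.
pose E k := if k == x.+1 then (fs F x + <[v]>)%VS else fs F k.
have [||G GE] := @flag_build E.
- move=> k kn; rewrite /E; case: eqP => [->|_]; last exact: fs_dim.
  by rewrite dim_add_line vx fs_dim ?addn1 //; lia.
- move=> k kn; rewrite /E; case: eqP => [->|/eqP kx].
    by rewrite gtn_eqF // subv_add -memvE v2 andbT fs_mono // leqW.
  case: eqP => [[->]|_]; first exact: addvSl.
  exact: fs_mono.
exists G; last by rewrite GE ?/E ?eqxx // ltnW.
by move=> k kn /eqP/negPf kx; rewrite GE // /E kx.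
Qed.

Lemma fs_flag_of (g : GL R n) k : (k <= n)%N ->
  fs (flag_of g) k = (\sum_(j < n | (j < k)%N) <[col j (sval g)]>)%VS.
Proof.
move=> kn; rewrite /fs /flag_space SubK /column_flag ffunE span_def big_map.
by rewrite big_filter inordK // big_enum_cond.
Qed.

Lemma flag_ofS (g : GL R n) (j : 'I_n) :
  fs (flag_of g) j.+1 = (fs (flag_of g) j + <[col j (sval g)]>)%VS.
Proof.
rewrite !fs_flag_of // 1?ltnW // [LHS](bigD1 j) //= addvC; congr (_ + _)%VS.
by apply: eq_bigl => l; rewrite ltnS andbC -(inj_eq val_inj) ltn_neqAle.
Qed.

Lemma fs_flag_ofM (g h gh : GL R n) k : sval gh = sval g *m sval h -> (k <= n)%N ->
  fs (flag_of gh) k = (linfun (mulmx (sval g)) @: fs (flag_of h) k)%VS.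
Proof.
move=> e kn; rewrite !fs_flag_of // limg_sum; apply: eq_bigr => j _.
by rewrite limg_line lfunE /= e !colE mulmxA.
Qed.

(** The columns of [g] are a basis adapted to the flag, one new vector per step. *)
Lemma flag_of_surj F : exists g, flag_of g = F.
Proof.
have [v vP] := fin_all_exists (fun j : 'I_n => flag_step F (ltn_ord j)).
pose g : 'M[C]_n := \matrix_(i, j) v j i 0.
have colg (j : 'I_n) : col j g = v j by apply/colP => i; rewrite !mxE.
have sumE k : (k <= n)%N -> fs F k = (\sum_(j < n | (j < k)%N) <[col j g]>)%VS.
  elim: k => [|k IH] kn; first by rewrite fs0 big_pred0.
  rewrite (vP (Ordinal kn)).2 /= IH 1?ltnW // [RHS](bigD1 (Ordinal kn)) //= addvC.
  rewrite colg; congr (_ + _)%VS.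
  by apply: eq_bigl => l; rewrite ltnS andbC -(inj_eq val_inj) ltn_neqAle.
have gu : g \in unitmx.
  have full : limg (linfun (mulmx g : 'cV[C]_n -> 'cV[C]_n)) = fullv.
    apply/eqP; rewrite eqEsubv subvf /= -[X in (X <= _)%VS](_ : fs F n = _).
      rewrite sumE //; apply/subv_sumP => j _; rewrite -memvE.
      by apply/memv_imgP; exists (delta_mx j 0); rewrite ?memvf // lfunE /= -colE.
    by apply/eqP; rewrite eqEdim subvf fs_dim // dimvf /dim /= muln1.
  by rewrite -row_full_unit /row_full -dim_limg_mulmx full dimvf /dim /= muln1.
exists (exist _ g gu); apply: flag_eq => k kn.
by rewrite fs_flag_of // sumE.
Qed.

End Flags.

Lemma sum_delta_lines (K : fieldType) (m : nat) :
  (\sum_(j < m) <[delta_mx j 0%R : 'cV[K]_m]> = fullv)%VS.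
Proof.
apply/eqP; rewrite eqEsubv subvf; apply/subvP => z _.
rewrite (matrix_sum_delta z) memv_sumr // => j _.
by rewrite big_ord1; apply: memvZ; exact: memv_line.
Qed.

Lemma limg_mulmx_cols (K : fieldType) (m1 m2 : nat) (M : 'M[K]_(m1, m2)) :
  limg (linfun (mulmx M : 'cV_m2 -> 'cV_m1)) = (\sum_j <[col j M]>)%VS.
Proof.
rewrite -sum_delta_lines limg_sum.
by apply: eq_bigr => j _; rewrite limg_line lfunE /= -colE.
Qed.

(** Multiplying [P] by the linear factors of the exceptional points gives a polynomial vanishing
    everywhere; the natural numbers, distinct in [K], are too many roots for it. *)
Lemma cofinite_roots (K : numDomainType) (P : {poly K}) (s : seq K) :
  (forall t, t \notin s -> P.[t] = 0) -> P = 0.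
Proof.
move=> P0; pose Q := \prod_(a <- s) ('X - a%:P).
have PQ t : root (P * Q) t.
  rewrite rootM root_prod_XsubC; case: (boolP (t \in s)); first by rewrite orbT.
  by move/P0/eqP => Pt; rewrite /root Pt.
have /eqP : P * Q = 0.
  apply: contraTeq (leqnn (size (P * Q))) => nz; rewrite -ltnNge.
  pose rs : seq K := [seq i%:R | i <- iota 0 (size (P * Q))].
  rewrite -[X in (X < _)%N](_ : size rs = _); last by rewrite size_map size_iota.
  apply: max_poly_roots nz _ _; first by apply/allP => t _; apply: PQ.
  by rewrite map_inj_uniq ?iota_uniq // => a b /eqP; rewrite Num.Theory.eqr_nat => /eqP.
by rewrite mulf_eq0 (negPf (monic_neq0 (monic_prod_XsubC _ _ _))) orbF => /eqP.
Qed.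

(** * Closed sets of flags *)

Section Zariski.
Variables (R : realType) (n : nat).
Local Notation C := R[i].
Local Notation V := 'cV[C]_n.
Implicit Types (g h : GL R n) (f : {mpoly C[n * n]}).

Local Notation eval_GL M := (meval (fun k => mxvec M 0 k)).

(** The equations may be taken to be all polynomials vanishing on [A]. *)
Lemma GL_closedP (A : set (GL R n)) : GL_closed A <->
  forall g, (forall f, (forall h, A h -> eval_GL (sval h) f = 0) -> eval_GL (sval g) f = 0) ->
    A g.
Proof.
split=> [[S ->] g H f Sf|H]; first by apply: H => h /(_ f Sf).
exists [set f | forall h, A h -> eval_GL (sval h) f = 0]%classic.
rewrite eqEsubset; split=> g /= Ag; first by move=> f; apply.
exact: H.
Qed.

Definition generic_matrix : 'M[{mpoly C[n * n]}]_n := \matrix_(i, j) 'X_(mxvec_index i j).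

Lemma eval_generic_matrix M : map_mx (eval_GL M) generic_matrix = M.
Proof. by apply/matrixP => i j; rewrite !mxE mevalXU mxvecE. Qed.

Lemma eval_const_mx M a b (A : 'M[C]_(a, b)) :
  map_mx (eval_GL M) (map_mx (@mpolyC (n * n) C) A) = A.
Proof. by apply/matrixP => i j; rewrite !mxE mevalC. Qed.

Lemma right_translate_poly (u : 'M[C]_n) f :
  exists f', forall M, eval_GL M f' = eval_GL (M *m u) f.
Proof.
pose l := [tuple mxvec (generic_matrix *m map_mx (@mpolyC (n * n) C) u) 0 k | k < n * n].
exists (f \mPo l) => M; rewrite comp_mpoly_meval; apply: meval_eq => k.
transitivity (map_mx (eval_GL M) (mxvec (generic_matrix *m map_mx (@mpolyC (n * n) C) u)) 0 k).
  by rewrite tnth_mktuple [RHS]mxE.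
by rewrite map_mxvec map_mxM eval_generic_matrix eval_const_mx.
Qed.

Lemma line_poly (M N : 'M[C]_n) f :
  exists P : {poly C}, forall t, P.[t] = eval_GL (M + t *: N) f.
Proof.
pose A := map_mx polyC M + 'X *: map_mx polyC N.
exists (mmap polyC (fun k => mxvec A 0 k) f) => t.
rewrite mevalE /mmap horner_sum; apply: eq_bigr => m _.
rewrite hornerM hornerC /mmap1 horner_prod; congr (_ * _); apply: eq_bigr => k _.
rewrite horner_exp; congr (_ ^+ _).
case/mxvec_indexP: k => i j; rewrite !mxvecE !mxE.
by rewrite hornerD hornerM hornerX !hornerC.
Qed.

(** If the rank at [g] exceeds [r], [rank_minor] yields a determinant of size [r.+1] that is 1 at
    [g] and vanishes wherever the rank is at most [r]. *)
Lemma rank_closed a b r (M : 'M[{mpoly C[n * n]}]_(a, b)) :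
  GL_closed [set g | \rank (map_mx (eval_GL (sval g)) M) <= r]%N%classic.
Proof.
apply/GL_closedP => g H /=; rewrite leqNgt; apply/negP => /rank_minor[P [Q e]].
pose f := \det (map_mx (@mpolyC (n * n) C) P *m M *m map_mx (@mpolyC (n * n) C) Q).
have fE h : eval_GL (sval h) f = \det (P *m map_mx (eval_GL (sval h)) M *m Q).
  by rewrite /f -det_map_mx !map_mxM !eval_const_mx.
suff : eval_GL (sval g) f = 0 by rewrite fE e det1 => /eqP; rewrite oner_eq0.
apply: H => h /= rk; rewrite fE; apply: contraTeq rk.
rewrite -unitfE -[_ \is a _]unitmxE => /mxrank_unit rk; rewrite -ltnNge -[r.+1]rk.
exact: leq_trans (mxrankM_maxl _ _) (mxrankM_maxr _ _).
Qed.

Lemma flag_closedP (Z : set (flag R n)) : flag_closed Z <->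
  forall g, (forall f, (forall h, Z (flag_of h) -> eval_GL (sval h) f = 0) ->
    eval_GL (sval g) f = 0) -> Z (flag_of g).
Proof. exact: GL_closedP. Qed.

Definition GL_mk (M : 'M[C]_n) (Mu : M \in unitmx) : GL R n :=
  exist (fun M : 'M[C]_n => is_true (M \in unitmx)) M Mu.

Fact GL_mul_unit g h : sval g *m sval h \in unitmx.
Proof. by rewrite unitmx_mul (valP g) (valP h). Qed.

Definition GL_mul g h : GL R n := GL_mk (GL_mul_unit g h).

Lemma fs_GL_mul g h k : (k <= n)%N ->
  fs (flag_of (GL_mul g h)) k = (linfun (mulmx (sval g)) @: fs (flag_of h) k)%VS.
Proof. exact: fs_flag_ofM. Qed.

Lemma adjacent_GL_mul x g h h' : adjacent x (flag_of h) (flag_of h') ->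
  adjacent x (flag_of (GL_mul g h)) (flag_of (GL_mul g h')).
Proof. by move=> adj k kn kx; rewrite !fs_GL_mul // adj. Qed.

(* The flags adjacent to [flag_of g] are the [flag_of (g u)] with [u] in a
   parabolic subgroup independent of [g], and right translations are continuous. *)
Lemma closed_adjacent x (Z : set (flag R n)) : flag_closed Z ->
  flag_closed [set F | forall G, adjacent x F G -> Z G]%classic.
Proof.
move=> /flag_closedP cZ; apply/flag_closedP => g H G; have [h <-] := flag_of_surj G.
move=> adj; apply: cZ => f fZ.
have gVu : invmx (sval g) \in unitmx by rewrite unitmx_inv (valP g).
pose gV : GL R n := GL_mk gVu; pose u := GL_mul gV h.
have [f' f'E] := right_translate_poly (sval u) f.
have gu : GL_mul g u = h by apply: val_inj; rewrite /= mulKVmx // (valP g).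
rewrite -gu /= -f'E; apply: H => h' /= Zh'; rewrite f'E; apply: (fZ (GL_mul h' u)).
(* Left multiplication by [h' g^-1] carries the adjacent flags of [g] and [h] to those of [h'] and
   [h' u]. *)
apply: Zh'; have /(adjacent_GL_mul (GL_mul h' gV)) := adj.
have -> : GL_mul (GL_mul h' gV) g = h'.
  by apply: val_inj; rewrite /= mulmxKV // (valP g).
suff -> : GL_mul (GL_mul h' gV) h = GL_mul h' u by [].
by apply: val_inj; rewrite /= mulmxA.
Qed.

(** The pencil consists of the flags of [g (1 + t N)], where [N] is elementary and adds [t] times
    column [x.+1] of [g] to column [x]. These matrices form a line through [g], and a polynomial
    vanishing at all but finitely many points of a line vanishes on it. *)
Lemma closed_pencil x (Z : set (flag R n)) F : flag_closed Z -> (x.+2 <= n)%N ->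
  exists v w, [/\ v \notin fs F x, fs F x.+1 = (fs F x + <[v]>)%VS,
    w \notin fs F x.+1, fs F x.+2 = (fs F x.+1 + <[w]>)%VS &
    forall s : seq C, (forall t, t \notin s -> forall G, adjacent x.+1 F G ->
        fs G x.+1 = (fs F x + <[v + t *: w]>)%VS -> Z G) -> Z F].
Proof.
move=> /flag_closedP cZ xn; have [g <-] := flag_of_surj F.
pose j1 := Ordinal xn; pose j0 : 'I_n := Ordinal (ltnW xn).
have new (j : 'I_n) : col j (sval g) \notin fs (flag_of g) j.
  have := congr1 (fun U : {vspace V} => \dim U) (flag_ofS g j).
  rewrite /= dim_add_line !fs_dim // ?(ltnW (ltn_ord j)) //.
  by case: (_ \notin _) => //; rewrite addn0 => /eqP; rewrite eqn_leq ltnn.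
exists (col j0 (sval g)), (col j1 (sval g)); split.
- exact: (new j0).
- exact: (flag_ofS g j0).
- exact: (new j1).
- exact: (flag_ofS g j1).
move=> s Hs; apply: cZ => f fZ.
pose N : 'M[C]_n := delta_mx j1 j0.
have N2 : N *m N = 0 by rewrite mul_delta_mx_0 // -(inj_eq val_inj) /= neq_ltn ltnSn.
have [P PE] := line_poly (sval g) (sval g *m N) f.
suff P0 : P = 0 by have := PE 0; rewrite P0 horner0 scale0r addr0.
apply: (cofinite_roots (s := s)) => t ts; rewrite PE.
have gtE : sval g + t *: (sval g *m N) = sval g *m (1%:M + t *: N).
  by rewrite mulmxDr mulmx1 scalemxAr.
(* As [N] has square zero, the inverse is [1 - t N]. *)
have ut : 1%:M + t *: N \in unitmx.
  have /mulmx1_unit[] // : (1%:M + t *: N) *m (1%:M - t *: N) = 1%:M.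
  rewrite mulmxDl mul1mx mulmxBr mulmx1 -scalemxAl -scalemxAr N2 !scaler0 subr0.
  by rewrite subrK.
have gt : sval g + t *: (sval g *m N) \in unitmx by rewrite gtE unitmx_mul (valP g).
pose h : GL R n := GL_mk gt; rewrite -[X in mxvec X]/(sval h); apply: fZ.
have colN (j : 'I_n) : col j (sval g *m N) = if j == j0 then col j1 (sval g) else 0.
  rewrite !colE -mulmxA; case: eqP => [->|/eqP jj].
    by rewrite mul_delta_mx.
  by rewrite mul_delta_mx_0 1?eq_sym // mulmx0.
have colh (j : 'I_n) : col j (sval h) =
    if j == j0 then col j0 (sval g) + t *: col j1 (sval g) else col j (sval g).
  rewrite /= linearD linearZ /= colN; case: eqP => [->|] //.
  by rewrite scaler0 addr0.
have before k : (k <= x)%N -> fs (flag_of h) k = fs (flag_of g) k.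
  move=> kx; have kn : (k <= n)%N by lia.
  rewrite !fs_flag_of //; apply: eq_bigr => j jk; rewrite colh ifN //.
  by rewrite -(inj_eq val_inj) /= neq_ltn (leq_trans jk).
have at_x1 : fs (flag_of h) x.+1 =
    (fs (flag_of g) x + <[col j0 (sval g) + t *: col j1 (sval g)]>)%VS.
  by rewrite (flag_ofS h j0) /= before // colh eqxx.
apply: (Hs t ts) => // k kn kx.
have [lt|gt1] := leqP k x; first exact: before.
have xk : (x.+1 < k)%N by lia.
apply/eqP; rewrite eqEdim !fs_dim // leqnn andbT.
have sub (j : 'I_n) : (j < k)%N -> (<[col j (sval g)]> <= fs (flag_of g) k)%VS.
  by move=> jk; rewrite fs_flag_of //; apply: (sumv_sup j).
rewrite fs_flag_of //; apply/subv_sumP => j jk; rewrite -memvE colh.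
case: eqP => _; last by rewrite memvE sub.
by rewrite memvD ?memvZ // memvE sub //=; lia.
Qed.

(** Killing the columns from [k] on presents the [k]-th space as the image of a square matrix linear
    in the entries of [g]. *)
Lemma fs_limg g k : (k <= n)%N ->
  fs (flag_of g) k = limg (linfun (mulmx (sval g *m pid_mx k) : V -> V)).
Proof.
move=> kn; rewrite limg_mulmx_cols fs_flag_of // big_mkcond /=.
apply: eq_bigr => j _; rewrite [in RHS]colE -mulmxA.
have -> : pid_mx k *m delta_mx j 0 = (j < k)%N%:R *: delta_mx j 0 :> 'cV[C]_n.
  rewrite -colE; apply/colP => i; rewrite !mxE eqxx andbT -natrM mulnb.
  by rewrite -(inj_eq val_inj); case: eqP => [->|]; rewrite ?andbF ?andbT.
by rewrite -scalemxAr -colE; case: (j < k)%N; rewrite ?scale1r // scale0r.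
Qed.

Lemma eval_product (M L N : 'M[C]_n) :
  map_mx (eval_GL M) (map_mx (@mpolyC (n * n) C) L *m
    (generic_matrix *m map_mx (@mpolyC (n * n) C) N)) = L *m (M *m N).
Proof.
by rewrite map_mxM map_mxM eval_generic_matrix !eval_const_mx.
Qed.

(** The dimension is the rank of a block row matrix with polynomial entries. Taking for [L1] the
    matrix of [pi'] or [pi], and for [L2] zero or the identity, covers the three families of
    conditions. *)
Lemma closed_dim_le (L1 L2 : 'M[C]_n) k j d : (k <= n)%N -> (j <= n)%N ->
  flag_closed [set F | \dim (linfun (mulmx L1 : V -> V) @: fs F k +
                             linfun (mulmx L2 : V -> V) @: fs F j) <= d]%N%classic.
Proof.
move=> kn jn.
pose M1 := map_mx (@mpolyC (n * n) C) L1 *m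
  (generic_matrix *m map_mx (@mpolyC (n * n) C) (pid_mx k : 'M[C]_n)).
pose M2 := map_mx (@mpolyC (n * n) C) L2 *m
  (generic_matrix *m map_mx (@mpolyC (n * n) C) (pid_mx j : 'M[C]_n)).
have imgM (A B : 'M[C]_n) : (linfun (mulmx A : V -> V) @: limg (linfun (mulmx B : V -> V)) =
    limg (linfun (mulmx (A *m B) : V -> V)))%VS.
  rewrite -limg_comp; apply: eq_in_limg => u _.
  by rewrite comp_lfunE !lfunE /= mulmxA.
have rankE g : \dim (linfun (mulmx L1 : V -> V) @: fs (flag_of g) k +
      linfun (mulmx L2 : V -> V) @: fs (flag_of g) j) =
    \rank (map_mx (eval_GL (sval g)) (row_mx M1 M2)).
  have E1 : map_mx (eval_GL (sval g)) M1 = L1 *m (sval g *m (pid_mx k : 'M[C]_n)).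
    exact: eval_product.
  have E2 : map_mx (eval_GL (sval g)) M2 = L2 *m (sval g *m (pid_mx j : 'M[C]_n)).
    exact: eval_product.
  clearbody M1 M2.
  by rewrite map_row_mx E1 E2 !fs_limg // !imgM -limg_mulmx_row dim_limg_mulmx.
apply: (eq_ind_r (@GL_closed R n) (rank_closed d (row_mx M1 M2))).
by rewrite eqEsubset; split=> g /=; rewrite rankE.
Qed.

End Zariski.

(** * Rank conditions on flags *)

Section ClanFlags.
Variables (R : realType) (p q : nat).
Local Notation C := R[i].
Local Notation n := (p + q)%N.
Local Notation V := 'cV[C]_n.
Local Notation pi := (proj_Ep R p q).
Implicit Types (F G : flag R n) (c : clan p q) (U : {vspace V}) (k j x : nat).

Definition coproj_Ep : 'End(V) := (\1 - pi)%VF.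
Local Notation pi' := coproj_Ep.

Lemma proj_EpK u : pi (pi u) = pi u.
Proof. by rewrite !proj_EpE col_mxKu. Qed.

Lemma coprojE u : pi' u = u - pi u.
Proof. by rewrite /coproj_Ep add_lfunE opp_lfunE id_lfunE. Qed.

Lemma coproj_proj u : pi' (pi u) = 0.
Proof. by rewrite coprojE proj_EpK subrr. Qed.

Lemma lker_proj : lker pi = Etq R p q.
Proof.
apply/vspaceP => u; rewrite memv_ker memEtq proj_EpE.
by rewrite col_mx_eq0 eqxx andbT.
Qed.

Lemma lker_coproj : lker pi' = Ep R p q.
Proof.
apply/vspaceP => u; rewrite memv_ker memEp coprojE proj_EpE -[u in u - _]vsubmxK.
by rewrite opp_col_mx add_col_mx subrr oppr0 addr0 col_mx_eq0 eqxx.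
Qed.

Lemma dim_cap_Ep U : (\dim (U :&: Ep R p q) + \dim (pi' @: U))%N = \dim U.
Proof. by rewrite -lker_coproj limg_ker_dim. Qed.

Lemma dim_cap_Etq U : (\dim (U :&: Etq R p q) + \dim (pi @: U))%N = \dim U.
Proof. by rewrite -lker_proj limg_ker_dim. Qed.

(** The sum of [U] and its projection is the direct sum of the two projections of [U]. *)
Lemma dim_proj_add U : \dim (pi @: U + U) = (\dim (pi' @: U) + \dim (pi @: U))%N.
Proof.
have -> : (pi @: U + U = pi' @: U + pi @: U)%VS.
  apply/eqP; rewrite eqEsubv !subv_add addvSr addvSl andbT; apply/andP; split.
    apply/subvP => u uU; rewrite -[u](subrK (pi u)) -coprojE.
    by apply: memv_add; apply: memv_img.
  apply/subvP => _ /memv_imgP[u uU ->]; rewrite coprojE addrC.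
  by apply: memv_add => //; rewrite memvN memv_img.
apply: dimv_disjoint_sum; apply/eqP; rewrite -subv0; apply/subvP => u.
rewrite memv_cap memv0 => /andP[/memv_imgP[a _ ->] /memv_imgP[b _ e]].
have := coproj_proj b; rewrite -e [pi' a]coprojE coprojE linearB /= proj_EpK subrr.
by rewrite subr0 => ->.
Qed.

(* By rank-nullity, [\dim (pi' @: F_k)] is [k - \dim (F_k :&: Ep)], and likewise
   for [pi] and [Etq]: all the conditions become bounds from above.  The boolean
   selects between equality and inequality, and [S] the indices concerned. *)
Definition rank_cmp (b : bool) : rel nat := if b then eq_op else leq.

Record flag_ranks (b : bool) (S : pred nat) c F : Prop := FlagRanks {
  ranks_plus : forall k, (k <= n)%N -> S k ->
    rank_cmp b (\dim (pi' @: fs F k) + clan_plus c k)%N k;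
  ranks_minus : forall k, (k <= n)%N -> S k ->
    rank_cmp b (\dim (pi @: fs F k) + clan_minus c k)%N k;
  ranks_cross : forall k j, (k <= j)%N -> (j <= n)%N -> S k -> S j ->
    rank_cmp b (\dim (pi @: fs F k + fs F j)) (j + clan_cross c k j)%N }.

(** The crossing condition at [k = j] is the sum of the other two, by [dim_proj_add] and
    [clan_rank_sum]. *)
Lemma ranks_diag b c F k : (k <= n)%N ->
  rank_cmp b (\dim (pi' @: fs F k) + clan_plus c k)%N k ->
  rank_cmp b (\dim (pi @: fs F k) + clan_minus c k)%N k ->
  rank_cmp b (\dim (pi @: fs F k + fs F k)) (k + clan_cross c k k)%N.
Proof.
by move=> kn; have := clan_rank_sum c kn; rewrite dim_proj_add; case: b => /=; lia.
Qed.

Lemma ranks_agree b x c c' F : agree_off x c c' ->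
  flag_ranks b (predC1 x) c F -> flag_ranks b (predC1 x) c' F.
Proof.
case=> ap am ac [rp rm rc]; split=> [k kn kx|k kn kx|k j kj jn kx jx].
- by rewrite -ap; [apply: rp|apply/eqP].
- by rewrite -am; [apply: rm|apply/eqP].
- by rewrite -ac //; [apply: rc|apply/eqP|apply/eqP].
Qed.

Lemma ranks_adjacent b x c F G : adjacent x F G ->
  flag_ranks b (predC1 x) c F -> flag_ranks b (predC1 x) c G.
Proof.
move=> adj [rp rm rc]; split=> [k kn /= /eqP kx|k kn /= /eqP kx|k j kj jn /= /eqP kx /eqP jx].
- by rewrite adj //; apply: rp => //; apply/eqP.
- by rewrite adj //; apply: rm => //; apply/eqP.
- by rewrite !adj ?(leq_trans kj) //; apply: rc => //; apply/eqP.
Qed.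

Lemma ranks_sub b (S S' : pred nat) c F : {subset S' <= S} ->
  flag_ranks b S c F -> flag_ranks b S' c F.
Proof.
move=> SS [rp rm rc]; split=> [k kn Sk|k kn Sk|k j kj jn Sk Sj].
- by apply: rp => //; apply: SS.
- by apply: rm => //; apply: SS.
- by apply: rc => //; apply: SS.
Qed.

Lemma ranks_eq_le S c F : flag_ranks true S c F -> flag_ranks false S c F.
Proof.
by case=> rp rm rc; split=> [k kn Sk|k kn Sk|k j kj jn Sk Sj];
  apply: eq_leq; apply/eqP; [apply: rp|apply: rm|apply: rc].
Qed.

(** Besides passing to images, this adds the index 0, where everything is trivial, and the diagonal
    case [k = j], given by [ranks_diag]. *)
Lemma clan_orbitP c F : clan_orbit R c F <-> flag_ranks true predT c F.
Proof.
split=> [[op om oc]|[rp rm rc]].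
  have rp k : (k <= n)%N -> (\dim (pi' @: fs F k) + clan_plus c k = k)%N.
    case: k => [|k] kn; first by rewrite fs0 limg0 dimv0 clan_plus0.
    have := op (inord k.+1); rewrite inordK // -/(fs F k.+1) => <- //.
    by rewrite addnC dim_cap_Ep fs_dim.
  have rm k : (k <= n)%N -> (\dim (pi @: fs F k) + clan_minus c k = k)%N.
    case: k => [|k] kn; first by rewrite fs0 limg0 dimv0 clan_minus0.
    have := om (inord k.+1); rewrite inordK // -/(fs F k.+1) => <- //.
    by rewrite addnC dim_cap_Etq fs_dim.
  split=> [k kn _|k kn _|k j kj jn _ _]; first exact/eqP/rp; first exact/eqP/rm.
  move: kj; rewrite leq_eqVlt => /orP[/eqP->|kj].
    by apply: ranks_diag => //; apply/eqP; [apply: rp|apply: rm].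
  have [k0|k0] := posnP k.
    by apply/eqP; rewrite k0 fs0 limg0 add0v fs_dim // clan_cross0 addn0.
  have := oc (inord k) (inord j); rewrite !inordK ?ltnS ?(leq_trans (ltnW kj)) //.
  by rewrite k0 kj /fs => /(_ isT) ->; apply/eqP.
split=> [i i0|i i0|i j /andP[i0 ij]]; rewrite !flag_spaceE.
- have := rp i (leq_ord i) isT; have := dim_cap_Ep (fs F i).
  by rewrite fs_dim ?leq_ord //= => + /eqP; lia.
- have := rm i (leq_ord i) isT; have := dim_cap_Etq (fs F i).
  by rewrite fs_dim ?leq_ord //= => + /eqP; lia.
- exact/eqP/(rc i j (ltnW ij) (leq_ord j)).
Qed.

Lemma closed_ranks_le c : flag_closed [set F | flag_ranks false predT c F]%classic.
Proof.
have piE : pi = linfun (mulmx (block_mx 1%:M 0 0 0 : 'M[C]_n) : V -> V).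
  apply/lfunP => u; rewrite lfunE proj_EpE /= -{2}[u]vsubmxK mul_block_col.
  by rewrite mul1mx !mul0mx !addr0.
pose L := block_mx 1%:M 0 0 0 : 'M[C]_n.
have pi'E : pi' = linfun (mulmx (1%:M - L) : V -> V).
  by apply/lfunP => u; rewrite coprojE !lfunE piE lfunE /= mulmxBl mul1mx.
have zE U : (linfun (mulmx 0 : V -> V) @: U = 0)%VS.
  apply/eqP; rewrite -subv0; apply/subvP => _ /memv_imgP[u _ ->].
  by rewrite lfunE /= mul0mx mem0v.
have oneE U : (linfun (mulmx 1%:M : V -> V) @: U = U)%VS.
  rewrite -[RHS]lim1g; apply: eq_in_limg => u _.
  by rewrite lfunE id_lfunE /= mul1mx.
apply/flag_closedP => g H.
(* A flag in the Zariski closure of the rank locus lies in every closed set containing it, so each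
   inequality can be treated alone. *)
have key Z : flag_closed Z -> (forall F, flag_ranks false predT c F -> Z F) -> Z (flag_of g).
  move=> /flag_closedP cZ DZ; apply: cZ => f fZ; apply: H => h Dh; exact/fZ/DZ.
split=> [k kn _|k kn _|k j kj jn _ _].
(* This bound makes the truncated subtraction below exact. *)
- have le : (clan_plus c k <= k)%N by have := clan_rank_sum c kn; lia.
  have := key _ (closed_dim_le (1%:M - L) 0 (k - clan_plus c k) kn kn).
  rewrite /= -pi'E zE addv0 => bound.
  suff : (\dim (pi' @: fs (flag_of g) k) <= k - clan_plus c k)%N.
    by rewrite -(leq_add2r (clan_plus c k)) subnK.
  apply: bound => F [rp _ _]; rewrite -(leq_add2r (clan_plus c k)) subnK // zE addv0.
  exact: rp.
- have le : (clan_minus c k <= k)%N by have := clan_rank_sum c kn; lia.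
  have := key _ (closed_dim_le L 0 (k - clan_minus c k) kn kn).
  rewrite /= -piE zE addv0 => bound.
  suff : (\dim (pi @: fs (flag_of g) k) <= k - clan_minus c k)%N.
    by rewrite -(leq_add2r (clan_minus c k)) subnK.
  apply: bound => F [_ rm _]; rewrite -(leq_add2r (clan_minus c k)) subnK // zE addv0.
  exact: rm.
- have := key _ (closed_dim_le L 1%:M (j + clan_cross c k j) (leq_trans kj jn) jn).
  rewrite /= -piE oneE; apply=> F [_ _ rc].
  by rewrite oneE; apply: rc.
Qed.

End ClanFlags.

(* [lia] compares dimensions of distinct subspaces up to conversion, which is
   intractable; they are turned into variables first. *)
Ltac dim_lia :=
  try unfold reverse_coercion;
  repeat match goal with |- context [@dimv ?K ?T ?U] =>
    generalize (@dimv K T U); intro end;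
  repeat match goal with
  | H : context [@dimv _ _ _] |- _ => clear H
  | H : is_true (_ <= _)%N |- _ => revert H
  | H : is_true (_ && _) |- _ => revert H
  | H : @eq nat _ _ |- _ => revert H
  end; clear; intros; lia.

(** * Changing a single space of a flag *)

Section Closure.
Variables (R : realType) (p q : nat).
Local Notation C := R[i].
Local Notation n := (p + q)%N.
Local Notation V := 'cV[C]_n.
Local Notation pi := (proj_Ep R p q).
Local Notation pi' := (coproj_Ep R p q).
Implicit Types (F G : flag R n) (c : clan p q) (k j x : nat) (u v w : V).

(** The conditions involving the index [x.+1] are all put in the form [f @: (X + <[v]>) + U], with
    [f] the identity or [U] zero where necessary, so that one lemma on such dimensions serves them
    all. *)
Lemma ranks_modify b c x F G v : (x.+2 <= n)%N ->
  flag_ranks b (predC1 x.+1) c F ->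
  adjacent x.+1 F G -> fs G x.+1 = (fs F x + <[v]>)%VS ->
  rank_cmp b (\dim (pi' @: (fs F x + <[v]>) + 0) + clan_plus c x.+1)%N x.+1 ->
  rank_cmp b (\dim (pi @: (fs F x + <[v]>) + 0) + clan_minus c x.+1)%N x.+1 ->
  (forall k, (k <= x)%N -> rank_cmp b
     (\dim (\1%VF @: (fs F x + <[v]>) + pi @: fs F k)) (x.+1 + clan_cross c k x.+1)%N) ->
  (forall j, (x.+2 <= j)%N -> (j <= n)%N -> rank_cmp b
     (\dim (pi @: (fs F x + <[v]>) + fs F j)) (j + clan_cross c x.+1 j)%N) ->
  flag_ranks b predT c G.
Proof.
move=> xn rF adj Gx; rewrite !addv0 -Gx => ra rb rc rd.
have [gp gm gc] := ranks_adjacent adj rF.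
split=> [k kn _|k kn _|k j kj jn _ _].
- by have [->//|kx] := eqVneq k x.+1; apply: gp.
- by have [->//|kx] := eqVneq k x.+1; apply: gm.
have [jx|jx] := eqVneq j x.+1.
  move: kj; rewrite jx leq_eqVlt => /orP[/eqP->|kx].
    by apply: ranks_diag => //; apply: ltnW.
  by have := rc k kx; rewrite lim1g addvC -(adj k) //; dim_lia.
have [kx|kx] := eqVneq k x.+1; last exact: gc.
have xj : (x.+2 <= j)%N by move: kj; rewrite kx leq_eqVlt eq_sym (negPf jx).
by have := rd j xj jn; rewrite kx -adj //; apply/eqP.
Qed.

(** Adding a vector raises a dimension by [~~ m], where [m] says that its image is already present;
    this matters only if the bound [b] is already attained. *)
Lemma leq_add_nmem (a b : nat) (m : bool) :
  (a <= b)%N -> ((b <= a)%N -> m) -> (a + ~~ m <= b)%N.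
Proof.
case: m => [|/=] ab ba; first by rewrite addn0.
by rewrite addn1 ltnNge; apply/negP => /ba.
Qed.

Lemma improve_ranks c x F : (x.+2 <= n)%N -> flag_ranks false (predC1 x.+1) c F ->
  exists2 G, adjacent x.+1 F G & flag_ranks false predT c G.
Proof.
move=> xn rF; have [rp rm rc] := rF.
have [x0 x1] : predC1 x.+1 x /\ predC1 x.+1 x.+2.
  by rewrite /= !neq_ltn !ltnSn orbT.
have [lx lx1] : (x <= n)%N /\ (x.+1 <= n)%N by dim_lia.
have [v [vX Fv]] := flag_step F lx1; have [w [wX Fw]] := flag_step F xn.
have F2E : fs F x.+2 = (fs F x + <[v]> + <[w]>)%VS by rewrite Fw Fv.
rewrite Fv in wX.
have mono k j : (k <= j)%N -> (j <= n)%N -> {subset fs F k <= fs F j}.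
  by move=> kj jn; apply/subvP/fs_mono.
(* These say that a condition is binding: [fs F x] alone attains the bound, so the new vector must
   not raise the dimension. *)
pose rA := (x.+1 <= \dim (pi' @: fs F x + 0) + clan_plus c x.+1)%N.
pose rB := (x.+1 <= \dim (pi @: fs F x + 0) + clan_minus c x.+1)%N.
pose rC k := (x.+1 + clan_cross c k x.+1 <= \dim (\1%VF @: fs F x + pi @: fs F k))%N.
pose rD j := (j + clan_cross c x.+1 j <= \dim (pi @: fs F x + fs F j))%N.
have stepP := clan_plus_step c lx1; have stepP1 := clan_plus_step c xn.
have stepN := clan_minus_step c lx1; have stepN1 := clan_minus_step c xn.
have rp0 := rp x lx x0; have rp2 := rp x.+2 xn x1.
have rm0 := rm x lx x0; have rm2 := rm x.+2 xn x1.
have notx k : (k <= x)%N -> predC1 x.+1 k by move=> kx /=; rewrite neq_ltn ltnS kx.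
have notx' j : (x.+2 <= j)%N -> predC1 x.+1 j by move=> xj /=; rewrite neq_ltn xj orbT.
suff [u [u2 uX hA hB [hC hD]]] : exists u, [/\ u \in fs F x.+2, u \notin fs F x,
    rA -> pi' u \in (pi' @: fs F x + 0)%VS,
    rB -> pi u \in (pi @: fs F x + 0)%VS &
    (forall k, (k <= x)%N -> rC k -> \1%VF u \in (\1%VF @: fs F x + pi @: fs F k)%VS) /\
    (forall j, (x.+2 <= j)%N -> (j <= n)%N -> rD j ->
       pi u \in (pi @: fs F x + fs F j)%VS)].
  have [G adj Gx] := flag_modify xn u2 uX; exists G => //.
  apply: (ranks_modify xn rF adj Gx) => [||k kx|j xj jn]; rewrite /= dim_limg_add_line.
  - rewrite addnAC; apply: leq_add_nmem; last exact: hA.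
    by move: rp0 => /=; rewrite !addv0; dim_lia.
  - rewrite addnAC; apply: leq_add_nmem; last exact: hB.
    by move: rm0 => /=; rewrite !addv0; dim_lia.
  - apply: leq_add_nmem; last exact: hC.
    have := rc k x kx lx (notx k kx) x0; have := clan_cross_stepr c k lx1.
    by rewrite /= !lim1g [(fs F x + _)%VS]addvC; dim_lia.
  - apply: leq_add_nmem; last exact: hD.
    have xj' : (x <= j)%N by dim_lia.
    have := rc x j xj' jn x0 (notx' j xj); have := clan_cross_stepl c j lx1.
    by rewrite /=; dim_lia.
(* For [u] in [fs F x.+2], the requirements are ordered: C at [k] implies C at larger indices, A and
   B; A and B each imply every D; D at [i] implies D at larger indices. It is enough to meet the
   strongest binding one. *)
have CA k u : (k <= x)%N -> \1%VF u \in (\1%VF @: fs F x + pi @: fs F k)%VS ->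
    pi' u \in (pi' @: fs F x + 0)%VS.
  move=> kx; rewrite id_lfunE lim1g => /memv_addP[a aX [_ /memv_imgP[d _ ->] ->]].
  by rewrite linearD /= coproj_proj addr0 addv0 memv_img.
have CB k u : (k <= x)%N -> \1%VF u \in (\1%VF @: fs F x + pi @: fs F k)%VS ->
    pi u \in (pi @: fs F x + 0)%VS.
  move=> kx; rewrite id_lfunE lim1g => /memv_addP[a aX [_ /memv_imgP[d dk ->] ->]].
  rewrite linearD /= proj_EpK addv0 memvD // memv_img //; exact: mono dk.
have CC k l u : (k <= l)%N -> (l <= x)%N -> \1%VF u \in (\1%VF @: fs F x + pi @: fs F k)%VS ->
    \1%VF u \in (\1%VF @: fs F x + pi @: fs F l)%VS.
  move=> kl lx'; apply: subvP; apply: addvS => //; apply/limgS/fs_mono => //.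
  exact: leq_trans lx' lx.
have AD j u : (x.+2 <= j)%N -> (j <= n)%N -> u \in fs F x.+2 ->
    pi' u \in (pi' @: fs F x + 0)%VS -> pi u \in (pi @: fs F x + fs F j)%VS.
  move=> xj jn u2; rewrite addv0 => /memv_imgP[a aX]; rewrite !coprojE => e.
  have -> : pi u = pi a + (u - a).
    by rewrite -[u in u - a](subrK (pi u)) e addrAC [a - _ - _]addrAC subrr sub0r addNKr.
  apply: memv_add; first exact: memv_img.
  by apply: memvB; [apply: mono u2|apply: mono aX => //; dim_lia].
have BD j u : pi u \in (pi @: fs F x + 0)%VS -> pi u \in (pi @: fs F x + fs F j)%VS.
  by apply: subvP; apply: addvS => //; apply: sub0v.
have DD i j u : (i <= j)%N -> (j <= n)%N -> pi u \in (pi @: fs F x + fs F i)%VS ->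
    pi u \in (pi @: fs F x + fs F j)%VS.
  by move=> ij jn; apply: subvP; apply: addvS => //; apply: fs_mono.
(* If a condition is binding, its analogue at [x.+2] allows a growth of at most one from [fs F x] to
   [fs F x.+2], so some [u] meets it. *)
have slow (f : 'End(V)) (U : {vspace V}) :
    (\dim (f @: fs F x.+2 + U) <= (\dim (f @: fs F x + U)).+1)%N ->
    exists2 u, u \in fs F x.+2 & (u \notin fs F x) && (f u \in f @: fs F x + U)%VS.
  by rewrite F2E; apply: slow_growth_vector.
have [exC|noC] := boolP [exists k : 'I_n.+1, (k <= x)%N && rC k].
  have exC' : exists k, (k <= x)%N && rC k by case/existsP: exC => k; exists k.
  case: (ex_minnP exC') => k /andP[kx rCk] mink.
  have [|u u2 /andP[uX uC]] := slow \1%VF (pi @: fs F k)%VS.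
    move: rCk; have := rc k x.+2 (leq_trans kx (leq_addl 2 x)) xn (notx k kx) x1.
    have := clan_cross_stepr c k xn; rewrite /rC /= !lim1g ![(fs F _ + _)%VS]addvC; dim_lia.
  exists u; split=> // [_|_|]; [exact: CA uC|exact: CB uC|split=> [l lx' rCl|j xj jn _]].
    by apply: CC uC => //; apply: mink; rewrite lx'.
  exact/BD/CB/uC.
have {}noC k : (k <= x)%N -> rC k = false.
  move=> kx; apply: contraNF noC => rCk; have kn : (k < n.+1)%N by dim_lia.
  by apply/existsP; exists (Ordinal kn); rewrite /= kx.
(* Were both binding, their sum would make C binding at [k = x], by [dim_proj_add] and
   [clan_rank_sum]. *)
have notAB : ~~ (rA && rB).
  apply/negP => /andP[]; have := noC x (leqnn x); rewrite /rA /rB /rC.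
  rewrite lim1g addvC dim_proj_add !addv0.
  have := clan_rank_sum c lx1; have := clan_cross_stepl c x.+1 lx1; dim_lia.
have [hA|nA] := boolP rA.
  have nB : rB = false by move: notAB; rewrite hA => /negbTE.
  have [|u u2 /andP[uX uA]] := slow pi' 0%VS.
    by move: hA rp2; rewrite /rA /= !addv0; dim_lia.
  exists u; split=> // [|]; first by rewrite nB.
  by split=> [k kx|j xj jn _]; [rewrite noC|apply: AD].
have [hB|nB] := boolP rB.
  have [|u u2 /andP[uX uB]] := slow pi 0%VS.
    by move: hB rm2; rewrite /rB /= !addv0; dim_lia.
  exists u; split=> //.
  by split=> [k kx|j xj jn _]; [rewrite noC|apply: BD].
have [exD|noD] := boolP [exists j : 'I_n.+1, (x.+2 <= j)%N && rD j].
  have exD' : exists j, [&& (x.+2 <= j)%N, (j <= n)%N & rD j].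
    by case/existsP: exD => j /andP[xj rDj]; exists j; rewrite xj rDj leq_ord.
  case: (ex_minnP exD') => j /and3P[xj jn rDj] minj.
  have [|u u2 /andP[uX uD]] := slow pi (fs F j).
    move: rDj; have := rc x.+2 j xj jn x1 (notx' j xj).
    by have := clan_cross_stepl c j xn; rewrite /rD /=; dim_lia.
  exists u; split=> //.
  split=> [k kx|l xl ln rDl]; first by rewrite noC.
  by apply: DD uD => //; apply: minj; rewrite xl ln.
exists v; split=> //.
  by rewrite F2E; apply/(subvP (addvSl _ _))/(subvP (addvSr _ _)); apply: memv_line.
split=> [k kx|j xj jn rDj]; first by rewrite noC.
by case/existsP: noD; exists (inord j); rewrite inordK // xj.
Qed.

(** The generic dimension is the minimum of one more than that for [fs F x] and that for
    [fs F x.+2]. As [x] is a left end, the plus, minus and [k <= x] crossing conditions prescribe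
    the first; as [y] is not one, those with [j >= x.+2] prescribe the second. *)
Lemma pencil_generic_ranks c (x y : 'I_n) F v w : y = x.+1 :> nat ->
  (x < clan_mate c x)%N -> (clan_mate c y <= y)%N ->
  flag_ranks true (predC1 x.+1) c F -> fs F x.+2 = (fs F x + <[v]> + <[w]>)%VS ->
  exists s : seq C, forall t, t \notin s -> forall G, adjacent x.+1 F G ->
    fs G x.+1 = (fs F x + <[v + t *: w]>)%VS -> flag_ranks true predT c G.
Proof.
move=> xy Lx nLy rF F2; have [rp rm rc] := rF.
have [x0 x1] : predC1 x.+1 x /\ predC1 x.+1 x.+2.
  by rewrite /= !neq_ltn !ltnSn orbT.
have xn : (x.+2 <= n)%N by rewrite -xy.
have [lx lx1] : (x <= n)%N /\ (x.+1 <= n)%N by dim_lia.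
have notx k : (k <= x)%N -> predC1 x.+1 k by move=> kx /=; rewrite neq_ltn ltnS kx.
have notx' j : (x.+2 <= j)%N -> predC1 x.+1 j by move=> xj /=; rewrite neq_ltn xj orbT.
pose X := fs F x.
have [ta hta] := pencil_generic_dim pi' X 0%VS v w.
have [tb htb] := pencil_generic_dim pi X 0%VS v w.
have [tc htc] := fin_all_exists (fun k : 'I_n.+1 =>
  pencil_generic_dim \1%VF X (pi @: fs F k)%VS v w).
have [td htd] := fin_all_exists (fun j : 'I_n.+1 =>
  pencil_generic_dim pi X (fs F j) v w).
(* One exceptional parameter for each condition. *)
exists (ta :: tb :: codom tc ++ codom td) => t.
rewrite !inE mem_cat !negb_or => /and4P[tta ttb ttc ttd] G adj Gx.
have [P1 N1] : clan_plus c x.+1 = clan_plus c x /\ clan_minus c x.+1 = clan_minus c x.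
  rewrite clan_plusS clan_minusS.
  case: (position_trichotomy c x) => [[e _ _]|[lt _ _]|[_ -> ->]].
  - by move: Lx; rewrite e ltnn.
  - by move: Lx; rewrite ltnNge ltnW.
  - by rewrite !addn0.
have stepP := clan_plus_step c xn; have stepN := clan_minus_step c xn.
apply: (ranks_modify xn rF adj Gx) => [||k kx|j xj jn].
- rewrite hta // /X -F2 !addv0; have := rp x lx x0; have := rp x.+2 xn x1.
  by move=> /= /eqP + /eqP; dim_lia.
- rewrite htb // /X -F2 !addv0; have := rm x lx x0; have := rm x.+2 xn x1.
  by move=> /= /eqP + /eqP; dim_lia.
- have kn : (k < n.+1)%N by dim_lia.
  have /(htc (Ordinal kn)) /= -> : t != tc (Ordinal kn).
    by apply: contraNneq ttc => ->; apply: codom_f.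
  rewrite /X -F2 !lim1g ![(fs F _ + _)%VS]addvC.
  have kx2 : (k <= x.+2)%N by dim_lia.
  have := rc k x kx lx (notx k kx) x0; have := rc k x.+2 kx2 xn (notx k kx) x1.
  have := clan_cross_stepr c k xn; have := clan_crossSr c k x.
  have -> : (clan_mate c x < k)%N = false.
    by apply/negbTE; rewrite -leqNgt (leq_trans kx (ltnW Lx)).
  by move=> /= + + /eqP + /eqP; dim_lia.
- have jn1 : (j < n.+1)%N by dim_lia.
  have /(htd (Ordinal jn1)) /= -> : t != td (Ordinal jn1).
    by apply: contraNneq ttd => ->; apply: codom_f.
  rewrite /X -F2; have xj' : (x <= j)%N by dim_lia.
  have := rc x j xj' jn x0 (notx' j xj); have := rc x.+2 j xj jn x1 (notx' j xj).
  have := clan_cross_stepl c j lx1; have := clan_crossSl c y j; rewrite xy.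
  have -> : (j <= clan_mate c y)%N = false.
    by apply/negbTE; rewrite -ltnNge (leq_ltn_trans nLy) // xy.
  by move=> /= + + /eqP + /eqP; dim_lia.
Qed.

End Closure.

(** * Orbit closures *)

Section Main.
Variables (R : realType) (p q : nat).
Local Notation C := R[i].
Local Notation n := (p + q)%N.
Local Notation V := 'cV[C]_n.
Local Notation pi := (proj_Ep R p q).
Local Notation pi' := (coproj_Ep R p q).
Implicit Types (F G : flag R n) (c : clan p q) (k j x : nat) (u v w : V).

(** Nothing crosses, so the two bounds on the projections of the [k]-th space add up to [k]. The sum
    of these projections contains that space, so both bounds are attained. *)
Lemma ranks_unmatched c F : (forall s, clan_mate c s <= s)%N ->
  flag_ranks false predT c F -> flag_ranks true predT c F.
Proof.
move=> /unmatched_clan um [rp rm rc].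
have cross0 k j : (k <= j)%N -> clan_cross c k j = 0%N.
  move=> kj; rewrite clan_crossE big1 // => s _; rewrite um; dim_lia.
have main k : (k <= n)%N -> (\dim (pi' @: fs F k) + clan_plus c k = k)%N /\
    (\dim (pi @: fs F k) + clan_minus c k = k)%N.
  move=> kn; have := rp k kn isT; have := rm k kn isT; have := clan_rank_sum c kn.
  rewrite cross0 //= addn0; have := dim_proj_add (fs F k).
  have := dimvS (addvSr (pi @: fs F k) (fs F k)); rewrite fs_dim //; dim_lia.
split=> [k kn _|k kn _|k j kj jn _ _].
- by apply/eqP; case: (main k kn).
- by apply/eqP; case: (main k kn).
apply/eqP/anti_leq; rewrite (rc k j kj jn isT isT : is_true (_ <= _)%N) cross0 // addn0.
by have := dimvS (addvSr (pi @: fs F k) (fs F j)); rewrite fs_dim.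
Qed.

(** The sum of the two numbers is [p + q], as nothing crosses, and their difference is [p - q]. *)
Lemma unmatched_count c : (forall s, clan_mate c s <= s)%N ->
  clan_plus c n = p /\ clan_minus c n = q.
Proof.
move=> /unmatched_clan um.
have total := clan_rank_sum c (leqnn n).
have cross0 : clan_cross c n n = 0%N.
  by rewrite clan_crossE big1 // => s _; rewrite um; dim_lia.
have pE : clan_plus c n = #|[pred s | clan_sign c s == Some true]|.
  rewrite clan_plusE card_sum_pred; apply: eq_bigr => s _.
  by rewrite /plus_step um ltnn orbF ltn_ord andbT.
have mE : clan_minus c n = #|[pred s | clan_sign c s == Some false]|.
  rewrite clan_minusE card_sum_pred; apply: eq_bigr => s _.
  by rewrite /minus_step um ltnn orbF ltn_ord andbT.
have := clan_count c; rewrite -pE -mE; dim_lia.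
Qed.

Lemma coordinate_flag (v : 'I_n -> V) : (\sum_j <[v j]> = fullv)%VS ->
  exists F, forall k, (k <= n)%N -> fs F k = (\sum_(j < n | (j < k)%N) <[v j]>)%VS.
Proof.
move=> full; pose g : 'M[C]_n := \matrix_(i, j) v j i 0.
have colg (j : 'I_n) : col j g = v j by apply/colP => i; rewrite !mxE.
have gu : g \in unitmx.
  rewrite -row_full_unit /row_full -dim_limg_mulmx limg_mulmx_cols.
  rewrite (eq_bigr (fun j : 'I_n => <[v j]>%VS)); last by move=> j _; rewrite colg.
  by rewrite full dimvf /dim /= muln1.
exists (flag_of (GL_mk gu)) => k kn; rewrite fs_flag_of //.
by apply: eq_bigr => j _; rewrite /= colg.
Qed.

(** A coordinate flag works: the + signs take, in order, the basis vectors of [Ep], and the - signs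
    those of [Etq]. By [ranks_unmatched], only upper bounds need checking. *)
Lemma unmatched_nonempty c : (forall s, clan_mate c s <= s)%N ->
  exists F, flag_ranks true predT c F.
Proof.
move=> um; have id := unmatched_clan um; have [pn qn] := unmatched_count um.
have plusE (s : 'I_n) : plus_step c s = (clan_sign c s == Some true).
  by rewrite /plus_step id ltnn orbF.
have minusE (s : 'I_n) : minus_step c s = ~~ plus_step c s.
  have := position_trichotomy c s; rewrite id ltnn => -[[_ + _]|[]|[]] //.
  by case: plus_step; case: minus_step.
have monoP i j : (i <= j)%N -> (j <= n)%N -> (clan_plus c i <= clan_plus c j)%N.
  move=> ij jn; rewrite !clan_plusE; apply: leq_sum => s _.
  by case: plus_step => //=; dim_lia.
have monoN i j : (i <= j)%N -> (j <= n)%N -> (clan_minus c i <= clan_minus c j)%N.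
  move=> ij jn; rewrite !clan_minusE; apply: leq_sum => s _.
  by case: minus_step => //=; dim_lia.
pose pos (s : 'I_n) := (if plus_step c s then clan_plus c s else p + clan_minus c s)%N.
have posP (s : 'I_n) : if plus_step c s then (pos s < p)%N else (p <= pos s < n)%N.
  rewrite /pos; have := clan_plusS c s; have := clan_minusS c s; rewrite minusE.
  have := monoP s.+1 n (ltn_ord s) (leqnn n); have := monoN s.+1 n (ltn_ord s) (leqnn n).
  by rewrite pn qn; case: (plus_step c s) => /=; dim_lia.
have posn (s : 'I_n) : (pos s < n)%N.
  by have := posP s; case: plus_step => [lt|/andP[]] //; apply: ltn_addr.
pose phi (s : 'I_n) := Ordinal (posn s).
have lt_pos (s s' : 'I_n) : (s < s')%N -> pos s <> pos s'.
  move=> ss' e; have := posP s; have := posP s'; move: e; rewrite /pos.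
  have := clan_plusS c s; have := clan_minusS c s; rewrite minusE.
  have := monoP s.+1 s' ss' (ltnW (ltn_ord s')).
  have := monoN s.+1 s' ss' (ltnW (ltn_ord s')).
  by case: (plus_step c s) => /=; case: (plus_step c s') => /=; dim_lia.
have phi_inj : injective phi.
  move=> s s' /(congr1 (@nat_of_ord n)) e; apply: val_inj.
  by case: (ltngtP s s') => // /lt_pos[]; rewrite -?[LHS]e.
have [|F FE] := @coordinate_flag (fun s => delta_mx (phi s) 0).
  by rewrite -[RHS]sum_delta_lines [RHS](reindex_inj phi_inj).
have piE (s : 'I_n) : pi (delta_mx (phi s) 0 : V) =
    if plus_step c s then delta_mx (phi s) 0 else 0.
  have := posP s; rewrite proj_EpE; case: (plus_step c s) => sp.
    rewrite -[RHS]vsubmxK; congr col_mx; apply/esym/colP => i; rewrite !mxE andbT.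
    by rewrite -(inj_eq val_inj) /= gtn_eqF // ltn_addr.
  apply/eqP; rewrite col_mx_eq0 eqxx andbT; apply/eqP/colP => i; rewrite !mxE andbT.
  by rewrite -(inj_eq val_inj) /= ltn_eqF //; have := ltn_ord i; dim_lia.
have dimE (f : 'End(V)) k : (k <= n)%N ->
    (\dim (f @: fs F k) <= \sum_s ((f (delta_mx (phi s) 0%R) != 0%R) && (s < k)))%N.
  move=> kn; rewrite FE // limg_sum; apply: leq_trans (dimv_leq_sum _ _ _) _.
  rewrite big_mkcond /=; apply: leq_sum => s _; rewrite limg_line dim_vline.
  by case: (s < k)%N; rewrite ?andbT ?andbF.
exists F; apply: ranks_unmatched => //; split=> /= [k kn _|k kn _|k j kj jn _ _].
- have := clan_rank_sum c kn; suff : (\dim (pi' @: fs F k) <= clan_minus c k)%N by dim_lia.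
  apply: leq_trans (dimE _ _ kn) _; rewrite clan_minusE; apply: leq_sum => s _.
  rewrite coprojE piE minusE; case: plus_step; rewrite ?subrr ?eqxx //=.
  by case: (s < k)%N; rewrite ?andbF ?andbT // leq_b1.
- have := clan_rank_sum c kn; suff : (\dim (pi @: fs F k) <= clan_plus c k)%N by dim_lia.
  apply: leq_trans (dimE _ _ kn) _; rewrite clan_plusE; apply: leq_sum => s _.
  rewrite piE; case: plus_step; rewrite ?eqxx //=.
  by case: (s < k)%N; rewrite ?andbF ?andbT // leq_b1.
- rewrite (addv_idPr _) ?fs_dim ?leq_addr //.
  apply: subv_trans (fs_mono F kj jn); rewrite FE ?(leq_trans kj) // limg_sum.
  apply/subv_sumP => s sk; rewrite limg_line piE; case: plus_step.
    exact: (sumv_sup s).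
  by rewrite -memvE mem0v.
Qed.

(** By induction, a flag with the ranks of [c'] has those of [c] away from [x.+1]; a general flag of
    the pencil then has all the ranks of [c]. *)
Lemma ranks_nonempty c : exists F, flag_ranks true predT c F.
Proof.
move: {2}(clan_weight c).+1 (ltnSn (clan_weight c)) => m.
elim: m c => [//|m IH] c; rewrite ltnS => cm.
have [/existsP[s0 Ls0]|noL] := boolP [exists s : 'I_n, s < clan_mate c s]%N; last first.
  apply: unmatched_nonempty => s; rewrite leqNgt.
  by apply: contraNN noL => Ls; apply/existsP; exists s.
have [c' [x [y [xy Lx nLy agr dec]]]] := clan_descent Ls0.
have [F rF] := IH c' (leq_trans dec cm); rewrite xy in agr.
have {}rF : flag_ranks true (predC1 x.+1) c F.
  by apply: (ranks_agree (agree_offC agr)); apply: ranks_sub rF.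
have xn : (x.+2 <= n)%N by rewrite -xy.
have [v [vX Fv]] := flag_step F (ltnW xn); have [w [wX Fw]] := flag_step F xn.
have F2 : fs F x.+2 = (fs F x + <[v]> + <[w]>)%VS by rewrite Fw Fv.
have [s gen] := pencil_generic_ranks xy Lx nLy rF F2.
(* The field is infinite: otherwise the polynomial 1 would satisfy [cofinite_roots] vacuously. *)
have [t ts] : exists t, t \notin s.
  apply: boolp.contrapT => none; have /eqP : 1 = 0 :> {poly C}; last by rewrite oner_eq0.
  by apply: (cofinite_roots (s := s)) => t ts; case: none; exists t.
have [||G adj Gx] := @flag_modify _ _ x F (v + t *: w) xn.
- rewrite F2; apply: memv_add; last exact/memvZ/memv_line.
  exact/(subvP (addvSr _ _))/memv_line.
- have [->|t0] := eqVneq t 0; first by rewrite scale0r addr0.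
  apply: contra wX => vtwX; rewrite Fv -[w](scalerK t0) memvZ //.
  rewrite -[t *: w](addKr v) addrC memvB //.
    exact: (subvP (addvSl _ _)).
  exact/(subvP (addvSr _ _))/memv_line.
by exists G; apply: (gen t ts).
Qed.

Lemma ranks_le_in_closure c F : flag_ranks false predT c F ->
  forall Z, flag_closed Z -> (forall G, flag_ranks true predT c G -> Z G) -> Z F.
Proof.
move: {2}(clan_weight c).+1 (ltnSn (clan_weight c)) => m.
elim: m c F => [//|m IH] c F; rewrite ltnS => cm rF Z cZ QZ.
have [/existsP[s0 Ls0]|noL] := boolP [exists s : 'I_n, s < clan_mate c s]%N; last first.
  apply/QZ/ranks_unmatched => // s; rewrite leqNgt.
  by apply: contraNN noL => Ls; apply/existsP; exists s.
have [c' [x [y [xy Lx nLy agr dec]]]] := clan_descent Ls0.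
rewrite xy in agr; have xn : (x.+2 <= n)%N by rewrite -xy.
have [G adj rG] : exists2 G, adjacent x.+1 F G & flag_ranks false predT c' G.
  by apply: improve_ranks => //; apply: (ranks_agree agr); apply: ranks_sub rF.
(* The induction hypothesis is applied to the closed set of flags all of whose adjacent flags lie in
   [Z]; [F] is adjacent to its member [G]. *)
apply: (IH c' G (leq_trans dec cm) rG _ (closed_adjacent x.+1 cZ)); last exact: adjacentC.
move=> F1 rF1 F2 adj2.
have {}rF1 : flag_ranks true (predC1 x.+1) c F2.
  apply: (ranks_adjacent adj2); apply: (ranks_agree (agree_offC agr)).
  exact: ranks_sub rF1.
have [v [w [vX Fv wX Fw pencil]]] := closed_pencil F2 cZ xn.
have E2 : fs F2 x.+2 = (fs F2 x + <[v]> + <[w]>)%VS by rewrite Fw Fv.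
have [s gen] := pencil_generic_ranks xy Lx nLy rF1 E2.
by apply: (pencil s) => t ts G' adj' G'x; apply: QZ; apply: (gen t ts).
Qed.

Lemma clan_orbit_closureP c F : clan_orbit_closure R c F <-> flag_ranks false predT c F.
Proof.
split=> [|rF Z [cZ QZ]].
  apply; split; first exact: closed_ranks_le.
  by move=> G /clan_orbitP; apply: ranks_eq_le.
by apply: (ranks_le_in_closure rF cZ) => G /clan_orbitP; apply: QZ.
Qed.

End Main.

Theorem theorem1p2 (R : realType) (p q : nat) (gamma tau : clan p q) :
  (clan_orbit_closure R gamma `<=` clan_orbit_closure R tau)%classic <->
  [/\ forall i : nat, (1 <= i <= p + q)%N ->
        (clan_plus gamma i >= clan_plus tau i)%N,
      forall i : nat, (1 <= i <= p + q)%N ->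
        (clan_minus gamma i >= clan_minus tau i)%N
    & forall i j : nat, (1 <= i)%N -> (i < j)%N -> (j <= p + q)%N ->
        (clan_cross gamma i j <= clan_cross tau i j)%N].
Proof.
split=> [sub|[le_p le_m le_c] F /clan_orbit_closureP rF].
  have [F rF] := ranks_nonempty R gamma.
  have /sub/clan_orbit_closureP[tp tm tc] : clan_orbit_closure R gamma F.
    exact/clan_orbit_closureP/ranks_eq_le.
  (* [F] has exactly the ranks of [gamma] and satisfies the bounds of [tau]. *)
  have [gp gm gc] := rF.
  split=> [i /andP[_ iN]|i /andP[_ iN]|i j i0 ij jn].
  - by have := gp i iN isT; have := tp i iN isT; move=> /= + /eqP; dim_lia.
  - by have := gm i iN isT; have := tm i iN isT; move=> /= + /eqP; dim_lia.
  - have := gc i j (ltnW ij) jn isT isT; have := tc i j (ltnW ij) jn isT isT.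
    by move=> /= + /eqP; dim_lia.
have le_p' k : (k <= p + q)%N -> (clan_plus tau k <= clan_plus gamma k)%N.
  by case: k => [|k] kn; [rewrite !clan_plus0|apply: le_p].
have le_m' k : (k <= p + q)%N -> (clan_minus tau k <= clan_minus gamma k)%N.
  by case: k => [|k] kn; [rewrite !clan_minus0|apply: le_m].
apply/clan_orbit_closureP; have [gp gm gc] := rF.
split=> /= [k kn _|k kn _|k j kj jn _ _].
- by have := gp k kn isT; have := le_p' k kn => /=; dim_lia.
- by have := gm k kn isT; have := le_m' k kn => /=; dim_lia.
apply: leq_trans (gc k j kj jn isT isT) _; rewrite leq_add2l.
have [->|k0] := posnP k; first by rewrite !clan_cross0.
move: kj; rewrite leq_eqVlt => /orP[/eqP kj|kj]; last exact: le_c.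
(* On the diagonal, the crossing inequality follows from the other two by [clan_rank_sum]. *)
rewrite -{}kj in jn *; have := clan_rank_sum gamma jn; have := clan_rank_sum tau jn.
by have := le_p' k jn; have := le_m' k jn; dim_lia.
Qed.
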